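(* Let $0<p<1/2$. Then the maximal operator $$\widetilde{\sigma}_{p}^{\kappa,*}f:=\sup_{n\geq 1}\frac{\left|\sigma_n^{\kappa}f\right|}{(n+1)^{1/p-2}}$$ is bounded from the martingale Hardy space $H_p(G)$ to the space $L_p(G)$; that is, there is a constant $c_p>0$ depending only on $p$ such that $\left\|\widetilde{\sigma}_{p}^{\kappa,*}f\right\|_{p}\leq c_p\|f\|_{H_p}$ for every martingale $f\in H_p(G)$.
   Context: Let $\mathbf{P}_+$ be the set of positive integers and $\mathbf{P}=\mathbf{P}_+\cup\{0\}$. Let $\mathbb{Z}_2=\{0,1\}$ be the discrete cyclic group of order 2 with the measure giving each singleton mass $1/2$. The Walsh group $G$ is the complete direct product of countably many copies of $\mathbb{Z}_2$, with elements $x=(x_0,x_1,\dots)$, $x_k\in\{0,1\}$, with coordinatewise addition modulo 2, product topology and product (Haar probability) measure $\mu$. For $x\in G$, $n\in\mathbf{P}$, the dyadic intervals are $I_0(x):=G$ and $I_n(x):=\{y\in G: y_i=x_i \text{ for } 0\le i<n\}$. Walsh-Kaczmarz system: $r_k(x):=(-1)^{x_k}$ is the $k$-th Rademacher function. For $n\in\mathbf{P}_+$ with binary expansion $n=\sum_{i\ge 0}n_i2^i$, $n_i\in\{0,1\}$, put $|n|:=\max\{j\in\mathbf{P}: n_j\neq 0\}$. Then $\kappa_0:=1$ and for $n\geq 1$ $$\kappa_n(x):=r_{|n|}(x)\prod_{k=0}^{|n|-1}\left(r_{|n|-1-k}(x)\right)^{n_k}.$$ Martingales and Hardy spaces: $F_k$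 is the $\sigma$-algebra generated by the dyadic intervals of measure $2^{-k}$. A martingale $f=(f^{(n)}:n\in\mathbf{P})$ is a martingale with respect to $(F_n:n\in\mathbf{P})$ on $(G,\mu)$. Its maximal function is $f^*:=\sup_{n\in\mathbf{P}}|f^{(n)}|$. For $0<p<\infty$, $\|g\|_p:=\left(\int_G|g|^p\,d\mu\right)^{1/p}$ is the (quasi)norm of $L_p(G)$, and $H_p(G)$ consists of all martingales $f$ with $\|f\|_{H_p}:=\|f^*\|_p<\infty$. Fourier coefficients and Fejér means: for a martingale $f$, the Walsh-Kaczmarz-Fourier coefficients are $\widehat{f}(i):=\lim_{k\to\infty}\int_G f^{(k)}\kappa_i\,d\mu$ for $i\in\mathbf{P}$, the partial sums are $S_M^{\kappa}f:=\sum_{i=0}^{M-1}\widehat{f}(i)\kappa_i$ (with $S_0^{\kappa}f:=0$), and for $n\ge 1$ the Walsh-Kaczmarz-Fejér means are $\sigma_n^{\kappa}f:=\frac1n\sum_{j=0}^{n-1}S_j^{\kappa}f$. *)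

(* Defs.v *)
From HB Require Import structures.
From mathcomp Require Import all_boot all_order all_algebra.
From mathcomp Require Import all_classical all_reals all_analysis.
From mathcomp Require Import measurable_realfun.
From mathcomp Require Import ring lra.
Set Implicit Arguments.
Unset Strict Implicit.
Unset Printing Implicit Defensive.
Import Order.TTheory GRing.Theory Num.Theory.
Import numFieldNormedType.Exports.
Local Open Scope classical_set_scope.
Local Open Scope ring_scope.

(* Z_2 is bool (false = 0, true = 1).  The sigma-algebra is the Borel one of the
   product topology carried by cantor_space; see measurable_walsh_group.  The
   group law itself plays no role below. *)
Definition walsh_group : Type := g_sigma_algebraType (@open cantor_space).

HB.instance Definition _ := Pointed.on walsh_group.
HB.instance Definition _ := Measurable.on walsh_group.

Definition coord (x : walsh_group) (k : nat) : bool := x k.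

Definition dyadic_interval (n : nat) (x : walsh_group) : set walsh_group :=
  [set y | forall i, (i < n)%N -> coord y i = coord x i].

Definition dyadic_intervals (n : nat) : set (set walsh_group) :=
  range (dyadic_interval n).

Lemma open_dyadic_interval n x :
  @open cantor_space (dyadic_interval n x).
Proof.
elim: n => [|n IH].
  have -> : dyadic_interval 0 x = setT by rewrite -subTset => y _ i.
  exact: openT.
have -> : dyadic_interval n.+1 x =
    dyadic_interval n x `&` (proj n : cantor_space -> bool) @^-1` [set coord x n].
  apply/seteqP; split=> y /= h.
    by split=> [i ilt|]; apply: h => //; exact: ltnW.
  by move=> i; rewrite ltnS leq_eqVlt => /orP[/eqP ->|/(h.1 i)//]; exact: h.2.
apply: openI => //; apply: open_comp; last exact: discrete_open.
by move=> + _; exact: proj_continuous.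
Qed.

Lemma open_dyadic_base (U : set cantor_space) x :
  open U -> U x -> exists n, dyadic_interval n x `<=` U.
Proof.
move=> oU Ux.
pose F : set_system cantor_space := filter_from setT (dyadic_interval ^~ x).
have FF : Filter F.
  apply: filter_from_filter; first by exists 0%N.
  move=> m n _ _; exists (maxn m n) => // y h; split=> i ilt; apply: h.
    by rewrite (leq_trans ilt)// leq_maxl.
  by rewrite (leq_trans ilt)// leq_maxr.
suff : F --> (x : cantor_space).
  by move=> /(_ U)[|n _ nU]; [exact: open_nbhs_nbhs|exists n].
apply/cvg_sup => i A.
have /= -> := @nbhsE (initial_topology (fun f : cantor_space => f i)) x.
case=> B [[C oC <- Cx] BA]; exists i.+1 => // y h; apply: BA => /=.
by have := h i (leqnn _); rewrite /coord => ->.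
Qed.

Lemma measurable_walsh_group :
  @measurable _ walsh_group = <<s \bigcup_n dyadic_intervals n >>.
Proof.
have -> : @measurable _ walsh_group = <<s @open cantor_space >> by [].
have sa (G : set (set walsh_group)) : sigma_algebra setT <<s G >>.
  exact: (smallest_sigma_algebra setT).
apply/seteqP; split.
- apply: smallest_sub; first exact: sa.
  move=> U oU.
  pose cyl (s : seq bool) : set walsh_group :=
    dyadic_interval (size s) (nth false s : walsh_group).
  pose D (s : seq bool) := if pselect (cyl s `<=` U) then cyl s else set0.
  have -> : U = \bigcup_s D s.
    apply/seteqP; split=> [x Ux|x [s _]]; last first.
      by rewrite /D; case: pselect => // sU; exact: sU.
    have [n nU] := open_dyadic_base oU Ux.
    have E : cyl (mkseq (coord x) n) = dyadic_interval n x.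
      rewrite /cyl size_mkseq; apply/seteqP; split => y /= h i ilt;
      by rewrite h// /coord nth_mkseq.
    exists (mkseq (coord x) n) => //.
    by rewrite /D E; case: pselect.
  apply: (@countable_bigcupT_measurable _
    (g_sigma_algebraType (\bigcup_n dyadic_intervals n))) => //.
  move=> s; rewrite /D; case: pselect => sU; last exact: measurable0.
  by apply: sub_sigma_algebra; exists (size s) => //; exists (nth false s).
- apply: smallest_sub; first exact: sa.
  move=> A [n _ [x _ Ax]]; rewrite -Ax; apply: sub_sigma_algebra.
  exact: open_dyadic_interval.
Qed.

Definition cylinder (n : nat) (A : nat -> set bool) : set walsh_group :=
  [set y | forall i, (i < n)%N -> A i (coord y i)].

Definition is_product_measure (R : realType) (P : set walsh_group -> \bar R) :=
  forall n (A : nat -> set bool),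
    (P (cylinder n A) = \prod_(i < n) bernoulli_prob 2^-1 (A i))%E.

Lemma measurable_coord k : measurable_fun [set: walsh_group] (coord ^~ k).
Proof.
move=> _ Y _; rewrite setTI; apply: sub_sigma_algebra.
apply: (@open_comp cantor_space bool (fun y => y k)); last exact: discrete_open.
by move=> + _; exact: (@proj_continuous _ (fun=> bool) k).
Qed.

Lemma measurable_cylinder n A : measurable (cylinder n A).
Proof.
have -> : cylinder n A =
    \bigcap_i (if (i < n)%N then (coord ^~ i) @^-1` (A i) else setT).
  apply/seteqP; split=> y /= h i.
    by move=> _; case: ifP => // /h.
  by move=> ilt; have := h i I; rewrite ilt.
apply: bigcapT_measurable => i; case: ifP => // _.
by rewrite -[X in measurable X]setTI; exact: measurable_coord.
Qed.

Lemma measurable_dyadic_interval n x : measurable (dyadic_interval n x).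
Proof. by apply: sub_sigma_algebra; exact: open_dyadic_interval. Qed.

Section existence.
Context {R : realType}.
Implicit Types (t : R) (n : nat).

Let doubling t : R := if 2^-1 <= t then 2 * t - 1 else 2 * t.
Let digits t : walsh_group := fun k => 2^-1 <= iter k doubling t.

Let measurable_digits : measurable_fun [set: R] digits.
Proof.
have md : measurable_fun [set: R] doubling.
  apply: measurable_fun_ifT.
  - exact: measurable_fun_ler.
  - by apply: measurable_funB => //; exact: measurable_funM.
  - exact: measurable_funM.
have mi k : measurable_fun [set: R] (iter k doubling).
  elim: k => [|k IH]; first exact: measurable_id.
  by rewrite (_ : iter _ _ = doubling \o iter k doubling)//;
    exact: measurableT_comp.
have mk k : measurable_fun [set: R] (fun t => coord (digits t) k).
  by apply: measurable_fun_ler => //; exact: mi.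
move=> _ Y; rewrite measurable_walsh_group setTI => mY.
suff : [set Y | measurable (digits @^-1` Y)] Y by [].
apply: (smallest_sub _ _ mY).
  split => /=.
  - by rewrite preimage_set0; exact: measurable0.
  - by move=> A mA; rewrite setTD preimage_setC; exact: measurableC.
  - by move=> F mF; rewrite preimage_bigcup; exact: bigcupT_measurable.
move=> _ [n _ [x _ <-]] /=.
have -> : digits @^-1` dyadic_interval n x =
    \bigcap_i (if (i < n)%N then (fun t => coord (digits t) i) @^-1` [set coord x i]
               else setT).
  apply/seteqP; split=> t /= h i.
    by move=> _; case: ifP => // /h.
  by move=> ilt; have := h i I; rewrite ilt.
apply: bigcapT_measurable => i; case: ifP => // _.
by rewrite -[X in measurable X]setTI; exact: mk.
Qed.

Let digits_interval n (x : walsh_group) : exists a : R,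
  [/\ 0 <= a, a + 2^-1 ^+ n <= 1 & forall t, 0 <= t < 1 ->
    dyadic_interval n x (digits t) <-> a <= t < a + 2^-1 ^+ n].
Proof.
elim: n x => [|n IH] x.
  by exists 0; split; rewrite ?expr0 ?add0r.
have [a [a0 a1 h]] := IH (fun k => coord x k.+1).
set e := 2^-1 ^+ n in a1 h; have e0 : 0 < e by rewrite exprn_gt0.
have E : dyadic_interval n.+1 x = [set y | coord y 0 = coord x 0 /\
   dyadic_interval n (fun k => coord x k.+1) (fun k => coord y k.+1)].
  apply/seteqP; split=> y /= H; first by split=> [|i il]; exact: H.
  by case=> [_|i]; [exact: H.1|rewrite ltnS => /H.2].
exists ((a + (coord x 0)%:R) / 2); rewrite exprS -/e.
split.
- by case: (coord x 0) => /=; lra.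
- by case: (coord x 0) => /=; lra.
move=> t t01.
have sh : (fun k => coord (digits t) k.+1) = digits (doubling t).
  by apply/funext => k; rewrite /coord /digits iterSr.
have d01 : 0 <= doubling t < 1.
  by rewrite /doubling; case: ifPn; rewrite -?ltNge => ?; lra.
have {}h := h _ d01.
rewrite E /= sh h /coord /digits /= -/(coord x 0).
case: (coord x 0); rewrite /doubling; case: (lerP 2^-1 t) => ht /=;
  split; (try by case); try (move=> H; split => //); try case; lra.
Qed.

Let mI : measurable (`[0%R, 1%R[%classic : set R).
Proof. exact: measurable_itv. Qed.

Let dyadic_probability : exists P : probability walsh_group R,
  forall n x, P (dyadic_interval n x) = (2^-1 ^+ n)%:E.
Proof.
pose P : {measure set walsh_group -> \bar R} :=
  pushforward (mrestr lebesgue_measure mI) digits.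
pose P0 := P measurable_digits.
have P0E n x : P0 (dyadic_interval n x) = (2^-1 ^+ n)%:E.
  have [a [a0 a1 h]] := digits_interval n x.
  have e0 : 0 < 2^-1 ^+ n :> R by rewrite exprn_gt0.
  rewrite /P0 /P /= /pushforward /mrestr.
  have -> : digits @^-1` dyadic_interval n x `&` `[0, 1[ = `[a, a + 2^-1 ^+ n[%classic.
    apply/seteqP; split=> t /=; rewrite !in_itv /=.
      by move=> [H t01]; apply/h.
    move=> H; have t01 : 0 <= t < 1 by lra.
    by split => //; apply/h.
  by rewrite lebesgue_measure_itv /= lte_fin ltrDl e0 -EFinD addrC addKr.
have P0T : P0 setT = 1%E.
  have -> : [set: walsh_group] = dyadic_interval 0 (fun=> false).
    by apply/esym; rewrite -subTset => y _ i.
  by rewrite P0E expr0.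
exists (mnormalize P0 (dirac point)) => n x.
have E A : mnormalize P0 (dirac point) A = P0 A.
  by rewrite /mnormalize P0T onee_eq0 /= invr1 mule1.
by rewrite -(P0E n x) -E.
Qed.

Lemma product_measure_exists :
  exists P : probability walsh_group R, is_product_measure P.
Proof.
have [P PE] := dyadic_probability; exists P => n A.
pose C k (x : walsh_group) m :=
  dyadic_interval k x `&` [set y | forall i, (i < m)%N -> A (k + i)%N (coord y (k + i))].
have mC k x m : measurable (C k x m).
  apply: measurableI; first exact: measurable_dyadic_interval.
  rewrite (_ : [set y | _] = cylinder (k + m)
    (fun i => if (i < k)%N then setT else A i)); first exact: measurable_cylinder.
  apply/seteqP; split=> y /= h i ilt.
    by case: ltnP => // ki; have := h (i - k)%N; rewrite ltn_subLR// subnKC//; apply.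
  by have := h (k + i)%N; rewrite ltn_add2l => /(_ ilt); rewrite ltnNge leq_addr.
suff PC m k x : (P (C k x m) =
    (2^-1 ^+ k)%:E * \prod_(i < m) bernoulli_prob 2^-1 (A (k + i)%N))%E.
  have := PC n 0 (fun=> false); rewrite expr0 mul1e => <-; congr (P _).
  by apply/seteqP; split=> y /= => [h|[_ h]]; [split|].
elim: m k x => [|m IH] k x.
  rewrite big_ord0 mule1 -(PE k x); congr (P _).
  by apply/seteqP; split=> y /= => [[]//|h]; split.
pose xb b : walsh_group := fun i => if i == k then b else x i.
pose D b := if pselect (A k b) then C k.+1 (xb b) m else set0.
have mD b : measurable (D b).
  by rewrite /D; case: pselect => Ab; [exact: mC|exact: measurable0].
have CE : C k x m.+1 = D true `|` D false.
  apply/seteqP; split=> y.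
    move=> [/= h1 h2].
    have Ak : A k (coord y k) by have := h2 0 isT; rewrite addn0.
    have : D (coord y k) y.
      rewrite /D; case: pselect => //= Ay; split => /= i.
        rewrite ltnS leq_eqVlt /coord /xb; case: eqVneq => [->//|_ /= ilt].
        exact: h1.
      by move=> im; have := h2 i.+1; rewrite ltnS addnS addSn; exact.
    by case: (coord y k); [left|right].
  have H b : D b y -> C k x m.+1 y.
    rewrite /D; case: pselect => //= Ab [/= h1 h2].
    have yk : coord y k = b by rewrite (h1 k)// /coord /xb eqxx.
    split=> /= i ilt.
      by rewrite (h1 i) ?(leqW ilt)// /coord /xb ltn_eqF.
    case: i ilt => [|i]; first by rewrite addn0 yk.
    by rewrite ltnS addnS -addSn; exact: h2.
  by case; exact: H.
transitivity (P (D true) + P (D false))%E.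
  rewrite CE; apply: measureU => //.
  apply/seteqP; split=> y //= []; rewrite /D.
  case: pselect => //= a1 [/(_ k (leqnn _)) + _].
  case: pselect => //= a2 + [/(_ k (leqnn _)) + _].
  by rewrite /coord /xb eqxx => ->.
have PD b : (P (D b) = (2^-1)%:E * \d_b (A k) *
   ((2^-1 ^+ k)%:E * \prod_(i < m) bernoulli_prob 2^-1 (A (k.+1 + i)%N)))%E.
  rewrite /D; case: pselect => Ab; rewrite /= diracE.
    by rewrite mem_set// IH mule1 exprS EFinM muleA.
  by rewrite memNset// measure0 mule0 mul0e.
rewrite !PD big_ord_recl /= addn0.
under [in RHS]eq_bigr do rewrite /bump /= add1n addnS -addSn.
set Q := (\prod_(i < m) _)%E.
have bE : bernoulli_prob 2^-1 (A k) =
    ((2^-1)%:E * \d_true (A k) + (2^-1)%:E * \d_false (A k))%E :> \bar R.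
  rewrite bernoulli_probE; last by lra.
  by congr (_ + _ * _)%E; congr (_%:E); rewrite /unstable.onem; lra.
by rewrite bE -ge0_muleDl ?mule_ge0 ?lee_fin// muleCA.
Qed.

End existence.

Lemma product_measure_unique (R : realType) (P Q : probability walsh_group R) :
  is_product_measure P -> is_product_measure Q ->
  forall A, measurable A -> P A = Q A.
Proof.
move=> hP hQ A mA.
pose G : set (set walsh_group) := [set C | exists n B, C = cylinder n B].
apply: (@g_sigma_algebra_measure_unique _ _ _ G _ (fun=> setT)).
- by move=> _ [n [B ->]]; exact: measurable_cylinder.
- move=> _; exists 0%N, (fun=> setT).
  by apply/esym; rewrite -subTset => y _ i.
- by apply: bigcup_const; exists 0%N.
- move=> _ _ [n [B ->]] [m [B' ->]]; exists (maxn n m).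
  exists (fun i => (if (i < n)%N then B i else setT) `&`
                   (if (i < m)%N then B' i else setT)).
  apply/seteqP; split=> y.
    by move=> [h1 h2] i _; split; case: ifP => // ilt; [exact: h1|exact: h2].
  move=> h; split=> i ilt.
    by have [+ _] := h i (leq_trans ilt (leq_maxl _ _)); rewrite ilt.
  by have [_ +] := h i (leq_trans ilt (leq_maxr _ _)); rewrite ilt.
- by move=> _ [n [B ->]]; exact: etrans (hP n B) (esym (hQ n B)).
- by move=> _; rewrite -ge0_fin_numE// fin_num_measure.
- move: mA; rewrite measurable_walsh_group; apply: sub_sigma_algebra2.
  move=> _ [n _ [x _ <-]]; exists n, (fun i => [set coord x i]).
  by apply/seteqP; split.
Qed.

Definition haar (R : realType) : probability walsh_group R :=
  sval (cid (@product_measure_exists R)).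

Lemma haar_product (R : realType) : is_product_measure (haar R).
Proof. exact: svalP (cid (@product_measure_exists R)). Qed.

Lemma haar_dyadic_interval (R : realType) n x :
  haar R (dyadic_interval n x) = (2^-1 ^+ n)%:E.
Proof.
have -> : dyadic_interval n x = cylinder n (fun i => [set coord x i]).
  by apply/seteqP; split.
rewrite haar_product (eq_bigr (fun=> (2^-1 : R)%:E)) => [|i _].
  by rewrite prodEFin prodr_const card_ord.
rewrite bernoulli_probE; last by lra.
rewrite !diracE; case: (coord x i).
  by rewrite mem_set// memNset// mule1 mule0 adde0.
rewrite memNset// mem_set// mule1 mule0 add0e /unstable.onem.
by congr (_%:E); lra.
Qed.

Definition rademacher (R : realType) (k : nat) (x : walsh_group) : R :=
  (-1) ^+ coord x k.

Definition bit (n i : nat) : nat := odd (n %/ 2 ^ i).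

(* |n|; the range j < n loses nothing, since bit n j = 0 as soon as n < 2 ^ j. *)
Definition msb (n : nat) : nat := (\max_(j < n | bit n j != 0) j)%N.

Definition kaczmarz (R : realType) (n : nat) (x : walsh_group) : R :=
  if n == 0%N then 1
  else rademacher R (msb n) x *
       \prod_(k < msb n) rademacher R (msb n - 1 - k) x ^+ bit n k.

(* E[f n | F_m] = f m (a.e.) is expressed by its defining property on F_m. *)
Definition is_martingale (R : realType) (f : nat -> walsh_group -> R) : Prop :=
  [/\ forall n (B : set R), measurable B ->
        <<s dyadic_intervals n >> (f n @^-1` B),
      forall n, (haar R).-integrable setT (EFin \o f n)
    & forall m n, (m <= n)%N -> forall A, <<s dyadic_intervals m >> A ->
        (\int[haar R]_(x in A) (f n x)%:E = \int[haar R]_(x in A) (f m x)%:E)%E].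

Definition maximal_function (R : realType) (f : nat -> walsh_group -> R)
    (x : walsh_group) : \bar R :=
  ereal_sup [set `|f n x|%:E | n in [set: nat]].

Definition Hardy_norm (R : realType) (p : R) (f : nat -> walsh_group -> R) :
    \bar R :=
  ('N[haar R]_p%:E[maximal_function f])%E.

Definition in_Hardy (R : realType) (p : R) (f : nat -> walsh_group -> R) : Prop :=
  is_martingale f /\ (Hardy_norm p f < +oo)%E.

Definition fourier_coef (R : realType) (f : nat -> walsh_group -> R) (i : nat) : R :=
  limn (fun k => \int[haar R]_x (f k x * kaczmarz R i x)).

Definition partial_sum (R : realType) (f : nat -> walsh_group -> R) (M : nat)
    (x : walsh_group) : R :=
  \sum_(i < M) fourier_coef f i * kaczmarz R i x.

Definition fejer_mean (R : realType) (f : nat -> walsh_group -> R) (n : nat)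
    (x : walsh_group) : R :=
  n%:R^-1 * \sum_(j < n) partial_sum f j x.

Definition weighted_fejer_maximal (R : realType) (p : R)
    (f : nat -> walsh_group -> R) (x : walsh_group) : \bar R :=
  ereal_sup [set (`|fejer_mean f n x| / (n.+1%:R `^ (p^-1 - 2)))%:E
            | n in [set n | (1 <= n)%N]].

(* Main.v *)
Require Import Defs.
From mathcomp Require Import all_boot all_order all_algebra.
From mathcomp Require Import all_classical all_reals all_analysis.
From mathcomp Require Import measurable_realfun.
From mathcomp Require Import ring lra zify.
Set Implicit Arguments.
Unset Strict Implicit.
Unset Printing Implicit Defensive.
Import Order.TTheory GRing.Theory Num.Theory.
Import numFieldNormedType.Exports.
Local Open Scope classical_set_scope.
Local Open Scope ring_scope.

(** Since [kaczmarz i] depends on the first [L] digits as soon as [i < 2 ^ L], the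
    Fejer means of order less than [2 ^ L] of a martingale [f] are those of the
    function [f L] of [L] digits.  All estimates are therefore made on functions of
    finitely many digits, uniformly in [L], where conditional expectations and
    integrals are iterated averages over single coordinates; monotone convergence
    in [L] concludes.  Throughout [w = 2 ^ p] and [th = w ^ 2 / 2], and the
    hypothesis [p < 1 / 2] says exactly that [th < 1].

    Kernel.  Let [2 ^ N <= n < 2 ^ N.+1].  The Kaczmarz functions of a dyadic block
    are Walsh-Paley functions of the reversed coordinates.  Peeling off binary
    digits bounds [n] times the Fejer kernel by a function [majorant N] independent
    of [n], a sum of terms [2 ^ s] times a product of factors [1 + r_j]
    ([fejer_kaczmarz_le]).  The expectation of such a factor is 1 and that of its
    [p]-th power is [w / 2 < 1]; by independence of the coordinates, the integral
    of the [p]-th power of the conditional expectation of [majorant N] given [F_M]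
    is at most a constant times [w ^ (N - M)] ([moment_majorant]).

    Atoms.  If [b] is bounded by an [F_M]-measurable [h] and has mean zero on the
    dyadic intervals of order [M], then its Fejer means of order at most [2 ^ M]
    vanish, and the others are bounded by the convolution of [h] with
    [majorant N / 2 ^ N], [N >= M].  For [p < 1] the function [u ^ p] is
    subadditive, which gives a form of Young's inequality ([powR_convolution]) in
    which only the coordinates below [M] are paid for.  After division by the weight
    the integral over all of [G] of the [p]-th power of the supremum over the [n]
    with leading digit [N] is at most a constant times [th ^ (N - M)] times the
    integral of [h ^ p].  This is summable over [N], so that neither the complement
    of the support nor the boundedness on [L_oo] need be treated separately
    ([atoms_bound]).

    Decomposition.  For the levels [lam 2 ^ k], stop [f] before it, or its value on
    the sibling interval, exceeds the level.  The differences of consecutive stopped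
    martingales, cut according to the time at which the lower level is first
    exceeded, are atoms, and the sum of the integrals of their [h ^ p] is controlled
    by the sum over [k] of [(lam 2 ^ k) ^ p] times the measure of the set where the
    maximal function exceeds [lam 2 ^ k], a geometric sum that is comparable to the
    integral of the [p]-th power of the maximal function ([weighted_max_bound]). *)

(** * Averaging over coordinates *)

Definition put (k : nat) (b : bool) (x : walsh_group) : walsh_group :=
  fun i => if i == k then b else x i.

Definition translate (x t : walsh_group) : walsh_group := fun i => x i (+) t i.

Definition depends (T : Type) (n : nat) (g : walsh_group -> T) : Prop :=
  forall x y : walsh_group, (forall i, (i < n)%N -> x i = y i) -> g x = g y.

Lemma put_id k (x : walsh_group) : put k (x k) x = x.
Proof. by apply/funext => i; rewrite /put; case: eqP => [->|]. Qed.

Lemma translateC x t : translate x t = translate t x.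
Proof. by apply/funext => i; rewrite /translate addbC. Qed.

Lemma translate_put k b x t :
  translate x (put k b t) = put k (x k (+) b) (translate x t).
Proof.
by apply/funext => i; rewrite /translate /put; case: eqP => [->|].
Qed.

Lemma depends_le T m n (g : walsh_group -> T) :
  (m <= n)%N -> depends m g -> depends n g.
Proof. by move=> mn gm x y h; apply: gm => i im; apply/h/(leq_trans im). Qed.

Lemma depends_put T n (g : walsh_group -> T) k b x :
  depends n g -> (n <= k)%N -> g (put k b x) = g x.
Proof.
move=> gn nk; apply: gn => i im; rewrite /put ifN//.
by apply: contraTneq im => ->; rewrite -leqNgt.
Qed.

Lemma depends_put_eq T n (g : walsh_group -> T) b :
  depends n.+1 g -> depends n (fun x => g (put n b x)).
Proof.
move=> gn x y h; apply: gn => i; rewrite /put; case: eqP => // /eqP ni.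
by rewrite ltnS leq_eqVlt (negbTE ni) => /h.
Qed.

Lemma depends_translate T n (g : walsh_group -> T) x :
  depends n g -> depends n (fun t => g (translate x t)).
Proof. by move=> gn t u h; apply: gn => i im; rewrite /translate h. Qed.

Section averages.
Context {R : realType}.
Implicit Types (g h : walsh_group -> R) (J K : seq nat).

Definition average (k : nat) g : walsh_group -> R :=
  fun x => (g (put k false x) + g (put k true x)) / 2.

Definition averages J g : walsh_group -> R := foldr average g J.

Lemma averages_cat J K g : averages (J ++ K) g = averages J (averages K g).
Proof. exact: foldr_cat. Qed.

Lemma averagesD J g h x :
  averages J (fun y => g y + h y) x = averages J g x + averages J h x.
Proof. by elim: J x => //= k J IH x; rewrite /average !IH; field. Qed.

Lemma averagesZ J c g x : averages J (fun y => c * g y) x = c * averages J g x.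
Proof. by elim: J x => //= k J IH x; rewrite /average !IH; field. Qed.

Lemma averages_cst J c x : averages J (fun=> c) x = c.
Proof. by elim: J x => //= k J IH x; rewrite /average !IH; field. Qed.

Lemma averages_sum (I : Type) (r : seq I) (P : pred I) J (g : I -> _ -> R) x :
  averages J (fun y => \sum_(i <- r | P i) g i y) x =
  \sum_(i <- r | P i) averages J (g i) x.
Proof.
elim: r => [|i r IH].
  by rewrite big_nil; under eq_fun do rewrite big_nil; rewrite averages_cst.
under eq_fun do rewrite big_cons; rewrite big_cons.
by case: (P i) => //; rewrite averagesD IH.
Qed.

Lemma ler_averages J g h x :
  (forall y, g y <= h y) -> averages J g x <= averages J h x.
Proof.
move=> gh; elim: J x => //= k J IH x.
by rewrite /average ler_pM2r// lerD.
Qed.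

Lemma averages_ge0 J g x : (forall y, 0 <= g y) -> 0 <= averages J g x.
Proof. by move=> g0; rewrite -(averages_cst J 0 x); exact: ler_averages. Qed.

Lemma ler_norm_averages J g x :
  `|averages J g x| <= averages J (fun y => `|g y|) x.
Proof.
rewrite ler_norml; apply/andP; split; last first.
  by apply: ler_averages => y; exact: ler_norm.
rewrite -mulN1r -averagesZ; apply: ler_averages => y.
by rewrite mulN1r lerNl -normrN; exact: ler_norm.
Qed.

(** Each of the two values averaged over a coordinate keeps half of its weight. *)
Lemma le_averages J g x :
  (forall y, 0 <= g y) -> g x <= 2 ^+ size J * averages J g x.
Proof.
move=> g0; elim: J x => [|k J IH] x; first by rewrite expr0 mul1r.
apply: (le_trans (IH x)); rewrite exprSr /= -mulrA ler_pM2l ?exprn_gt0//.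
have A0 y : 0 <= averages J g y by exact: averages_ge0.
rewrite -{1}(put_id k x) /average mulrC divfK//.
by case: (x k); rewrite ?lerDl ?lerDr.
Qed.

Lemma averages_translate J g x t :
  averages J (fun t => g (translate x t)) t = averages J g (translate x t).
Proof.
elim: J t => //= k J IH t; rewrite /average !IH !translate_put.
by congr (_ / _); case: (x k) => //=; rewrite addrC.
Qed.

Lemma averages_invarM J h g x :
  (forall k b y, k \in J -> h (put k b y) = h y) ->
  averages J (fun y => h y * g y) x = h x * averages J g x.
Proof.
elim: J x => //= k J IH x hJ; rewrite /average !IH.
- by rewrite !hJ ?mem_head//; ring.
- by move=> ? ? ? ?; apply: hJ; rewrite inE orbC; apply/orP; left.
- by move=> ? ? ? ?; apply: hJ; rewrite inE orbC; apply/orP; left.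
Qed.

Lemma averages_invar J g x :
  (forall k b y, k \in J -> g (put k b y) = g y) -> averages J g x = g x.
Proof.
move=> gJ; rewrite -[RHS]mulr1 -(averages_cst J 1 x) -averages_invarM//.
by congr (averages _ _ _); apply/funext => y; rewrite mulr1.
Qed.

Lemma averages_exchange J K (F : walsh_group -> walsh_group -> R) x t :
  averages J (fun x => averages K (F x) t) x =
  averages K (fun t => averages J (F ^~ t) x) t.
Proof.
elim: J x => //= k J IH x; rewrite /average !IH.
rewrite [RHS](_ : _ = averages K
  (fun t => 2^-1 * (averages J (F ^~ t) (put k false x)
                    + averages J (F ^~ t) (put k true x))) t).
  by rewrite averagesZ averagesD mulrC.
by congr (averages _ _ _); apply/funext => y; rewrite mulrC.
Qed.

Lemma depends_average n g : depends n.+1 g -> depends n (average n g).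
Proof.
by move=> gn x y xy; rewrite /average; congr ((_ + _) / _);
  exact: (depends_put_eq _ gn).
Qed.

Lemma depends_averages m d g :
  depends (m + d) g -> depends m (averages (iota m d) g).
Proof.
elim: d m => [|d IH] m; first by rewrite addn0.
by rewrite addnS -addSn => /IH; exact: depends_average.
Qed.

Lemma depends_averages0 n g x y :
  depends n g -> averages (iota 0 n) g x = averages (iota 0 n) g y.
Proof. by move=> gn; apply: depends_averages. Qed.

Lemma averages_depends n k d g :
  depends n g -> (n <= k)%N -> averages (iota k d) g = g.
Proof.
move=> gn nk; apply/funext => x; apply: averages_invar => j b y.
by rewrite mem_iota => /andP[kj _]; apply: depends_put gn (leq_trans nk kj).
Qed.

Lemma averages_iota_depends n k g :
  depends n g -> (n <= k)%N -> averages (iota 0 k) g = averages (iota 0 n) g.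
Proof.
move=> gn nk; rewrite -(subnKC nk) iotaD averages_cat add0n.
by rewrite (averages_depends _ gn).
Qed.

End averages.

(** * Subadditive powers *)

Section powers.
Context {R : realType}.
Variable p : R.
Hypothesis p01 : 0 < p < 1.

Let p0 : 0 <= p. Proof. by case/andP: p01 => /ltW. Qed.

Lemma powR_subadditive (a b : R) :
  0 <= a -> 0 <= b -> (a + b) `^ p <= a `^ p + b `^ p.
Proof.
move=> a0 b0; have [->|s0] := eqVneq (a + b) 0.
  by rewrite powR0 ?gt_eqF//; [rewrite addr_ge0 ?powR_ge0|case/andP: p01].
have s : 0 < a + b by rewrite lt_def s0 addr_ge0.
(* concavity at the origin: u <= u ^ p for u in [0, 1] *)
have H u : 0 <= u <= a + b -> u / (a + b) * (a + b) `^ p <= u `^ p.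
  move=> /andP[u0 us]; have [->|un0] := eqVneq u 0.
    by rewrite mul0r mul0r powR_ge0.
  have ugt : 0 < u by rewrite lt_def un0.
  have v0 : 0 <= u / (a + b) by rewrite divr_ge0// ltW.
  rewrite -{2}[u](divfK s0) powRM ?(ltW s)// ler_wpM2r ?powR_ge0//.
  apply: ger1_powR; last by case/andP: p01 => _ /ltW.
  by rewrite divr_gt0//= ler_pdivrMr// mul1r.
rewrite -[leLHS]mul1r -{1}(divff s0) mulrDl mulrDl.
by apply: lerD; apply: H; rewrite ?lerDl ?lerDr ?a0 ?b0.
Qed.

Lemma powR_sum (I : Type) (r : seq I) (P : pred I) (a : I -> R) :
  (forall i, 0 <= a i) ->
  (\sum_(i <- r | P i) a i) `^ p <= \sum_(i <- r | P i) a i `^ p.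
Proof.
move=> a0; elim: r => [|i r IH].
  by rewrite !big_nil powR0// gt_eqF//; case/andP: p01.
rewrite !big_cons; case: (P i) => //.
apply: (le_trans (powR_subadditive (a0 i) _)); first exact: sumr_ge0.
by rewrite lerD2l.
Qed.

Lemma powR_average k (g : walsh_group -> R) x : (forall y, 0 <= g y) ->
  average k g x `^ p <= 2 / 2 `^ p * average k (fun y => g y `^ p) x.
Proof.
move=> g0; have w0 : 2 `^ p != 0 :> R by rewrite gt_eqF// powR_gt0.
have A0 : 0 <= average k g x by rewrite divr_ge0// addr_ge0.
rewrite -(ler_pM2r (_ : 0 < 2 `^ p)) ?powR_gt0// -powRM//.
rewrite [leRHS](_ : _ = g (put k false x) `^ p + g (put k true x) `^ p).
  by rewrite /average divfK ?pnatr_eq0//; exact: powR_subadditive.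
by rewrite /average; field; rewrite w0.
Qed.

(** Sub-additivity of the p-th power costs a factor 2 ^ (1 - p) for each
    coordinate that is averaged. *)
Lemma powR_averages J (g : walsh_group -> R) x : (forall y, 0 <= g y) ->
  averages J g x `^ p <=
  (2 / 2 `^ p) ^+ size J * averages J (fun y => g y `^ p) x.
Proof.
move=> g0; elim: J x => [|k J IH] x; first by rewrite expr0 mul1r.
apply: le_trans (powR_average k x _) _; first by move=> y; exact: averages_ge0.
rewrite exprS -[leRHS]mulrA ler_pM2l ?divr_gt0 ?powR_gt0//.
by apply: le_trans (ler_averages [:: k] x IH) _; rewrite averagesZ.
Qed.
End powers.

(** * Binary digits *)

Lemma bit_small n k : (n < 2 ^ k)%N -> bit n k = 0%N.
Proof. by move=> nk; rewrite /bit divn_small. Qed.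

Lemma bit_addl A m k : (k < A)%N -> bit (2 ^ A + m) k = bit m k.
Proof.
move=> kA; rewrite /bit -(subnK (ltnW kA)) expnD.
by rewrite divnMDl ?expn_gt0// oddD oddX subn_eq0 leqNgt kA.
Qed.

Lemma bit_top A m : (m < 2 ^ A)%N -> bit (2 ^ A + m) A = 1%N.
Proof.
by move=> mA; rewrite /bit -{1}[(2 ^ A)%N]mul1n divnMDl ?expn_gt0// divn_small.
Qed.

Lemma msb_block A m : (m < 2 ^ A)%N -> msb (2 ^ A + m) = A.
Proof.
move=> mA; apply/eqP; rewrite eqn_leq; apply/andP; split.
  apply/bigmax_leqP => j; apply: contraR; rewrite -ltnNge => Aj.
  rewrite bit_small//; apply: (@leq_trans (2 ^ A.+1)); last by rewrite leq_pexp2l.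
  by rewrite expnS mul2n -addnn ltn_add2l.
have lt : (A < 2 ^ A + m)%N by rewrite ltn_addr// ltn_expl.
by apply: (@leq_bigmax_cond _ _ _ (Ordinal lt)); rewrite /= bit_top.
Qed.

Lemma leading_digit n :
  (0 < n)%N -> exists N m, (m < 2 ^ N)%N /\ n = (2 ^ N + m)%N.
Proof.
move=> n0; have /andP[le lt] := trunc_log_bounds (leqnn 2) n0.
exists (trunc_log 2 n), (n - 2 ^ trunc_log 2 n)%N; rewrite subnKC//; split=> //.
by rewrite ltn_subLR// addnn -mul2n -expnS.
Qed.

(** * Fejer sums of Walsh-type systems *)

Section fejer_sums.
Context {R : realType}.
Implicit Types (u : nat -> R) (e : nat -> R) (A m s : nat).

Definition dirichlet_sum u m : R := \sum_(i < m) u i.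

Definition fejer_sum u m : R := \sum_(j < m) dirichlet_sum u j.

Lemma dirichlet_sum_ext u v m :
  (forall i, (i < m)%N -> u i = v i) -> dirichlet_sum u m = dirichlet_sum v m.
Proof. by move=> uv; apply: eq_bigr => i _; exact: uv. Qed.

Lemma fejer_sum_ext u v m :
  (forall i, (i < m)%N -> u i = v i) -> fejer_sum u m = fejer_sum v m.
Proof.
move=> uv; apply: eq_bigr => j _; apply: dirichlet_sum_ext => i ij.
by apply: uv; exact: ltn_trans ij _.
Qed.

Lemma dirichlet_sumD u a m :
  dirichlet_sum u (a + m) = dirichlet_sum u a + dirichlet_sum (fun i => u (a + i)%N) m.
Proof. by rewrite /dirichlet_sum big_split_ord. Qed.

Lemma fejer_sumD u a m :
  fejer_sum u (a + m) =
  fejer_sum u a + m%:R * dirichlet_sum u a + fejer_sum (fun i => u (a + i)%N) m.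
Proof.
rewrite /fejer_sum big_split_ord /= -addrA; congr (_ + _).
under eq_bigr do rewrite dirichlet_sumD.
by rewrite big_split /= sumr_const card_ord mulr_natl.
Qed.

Lemma dirichlet_sumZ c u m :
  dirichlet_sum (fun i => c * u i) m = c * dirichlet_sum u m.
Proof. by rewrite /dirichlet_sum mulr_sumr. Qed.

Lemma fejer_sumZ c u m : fejer_sum (fun i => c * u i) m = c * fejer_sum u m.
Proof.
by rewrite /fejer_sum mulr_sumr; apply: eq_bigr => j _; exact: dirichlet_sumZ.
Qed.

(** The signs are a parameter, so that the identities below also hold for the
    blocks of the Kaczmarz system, whose signs are read in reversed order. *)
Definition walsh e A m : R := \prod_(k < A) e k ^+ bit m k.

Lemma walshS e A m : (m < 2 ^ A)%N -> walsh e A.+1 m = walsh e A m.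
Proof. by move=> mA; rewrite /walsh big_ord_recr/= bit_small// mulr1. Qed.

Lemma walsh_top e A m :
  (m < 2 ^ A)%N -> walsh e A.+1 (2 ^ A + m) = e A * walsh e A m.
Proof.
move=> mA; rewrite /walsh big_ord_recr/= bit_top// expr1 mulrC.
by congr (_ * _); apply: eq_bigr => k _; rewrite bit_addl.
Qed.

Lemma dirichlet_walshS e A :
  dirichlet_sum (walsh e A.+1) (2 ^ A) = dirichlet_sum (walsh e A) (2 ^ A).
Proof. by apply: dirichlet_sum_ext => i; exact: walshS. Qed.

Lemma dirichlet_walsh e A :
  dirichlet_sum (walsh e A) (2 ^ A) = \prod_(k < A) (1 + e k).
Proof.
elim: A => [|A IH].
  by rewrite /dirichlet_sum expn0 big_ord1 /walsh !big_ord0.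
rewrite expnS mul2n -addnn dirichlet_sumD dirichlet_walshS.
rewrite (dirichlet_sum_ext (@walsh_top e A)).
by rewrite dirichlet_sumZ IH big_ord_recr/=; ring.
Qed.

Lemma fejer_walshD e A m : (m <= 2 ^ A)%N ->
  fejer_sum (walsh e A.+1) (2 ^ A + m) =
  fejer_sum (walsh e A) (2 ^ A) + m%:R * \prod_(k < A) (1 + e k) +
  e A * fejer_sum (walsh e A) m.
Proof.
move=> mA; rewrite fejer_sumD dirichlet_walshS dirichlet_walsh -fejer_sumZ.
congr (_ + _ * _ + _); apply: fejer_sum_ext => i im; first exact: walshS.
by apply: walsh_top; exact: leq_trans im mA.
Qed.

(** The product that remains of the Dirichlet kernel of order [2 ^ A] once the
    [s]-th coordinate is left free. *)
Definition punctured e A s : R := \prod_(0 <= i < A | i != s) (1 + e i).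

Lemma puncturedS e A s :
  s != A -> punctured e A.+1 s = (1 + e A) * punctured e A s.
Proof.
move=> sA; rewrite /punctured big_mkcond big_nat_recr//= eq_sym sA mulrC.
by rewrite -big_mkcond.
Qed.

Lemma puncturedA e A s : (A <= s)%N -> punctured e A s = \prod_(k < A) (1 + e k).
Proof.
move=> As; rewrite -(big_mkord xpredT (fun k => 1 + e k)).
rewrite /punctured big_nat_cond [RHS]big_nat_cond.
apply: eq_bigl => i; rewrite andbT; case: (ltnP i A) => //= iA.
by rewrite neq_ltn (leq_trans iA As).
Qed.

Lemma puncturedSA e A : punctured e A.+1 A = punctured e A A.
Proof.
by rewrite /punctured big_mkcond big_nat_recr//= eqxx mulr1 -big_mkcond.
Qed.

Lemma punctured_ge0 e A s : (forall i, `|e i| <= 1) -> 0 <= punctured e A s.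
Proof.
move=> e1; apply: prodr_ge0 => i _.
by have := e1 i; rewrite ler_norml -lerBlDl sub0r => /andP[].
Qed.

(** Doubling the order multiplies the Fejer sum by [1 + e A] and adds [2 ^ A]
    Dirichlet kernels: unfolding this recursion, the kernels added at step [s] have
    no factor of index [s]. *)
Lemma fejer_walsh e A :
  fejer_sum (walsh e A) (2 ^ A) = \sum_(s < A) 2 ^+ s * punctured e A s.
Proof.
elim: A => [|A IH].
  by rewrite expn0 /fejer_sum big_ord1 /dirichlet_sum !big_ord0.
rewrite {1}expnS mul2n -addnn fejer_walshD// IH.
rewrite big_ord_recr/= puncturedSA puncturedA// natrX.
have -> : \sum_(s < A) 2 ^+ s * punctured e A.+1 s =
    (1 + e A) * \sum_(s < A) 2 ^+ s * punctured e A s.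
  rewrite mulr_sumr; apply: eq_bigr => s _.
  by rewrite puncturedS ?ltn_eqF//; ring.
by ring.
Qed.

Lemma fejer_walsh_ge0 e A :
  (forall i, `|e i| <= 1) -> 0 <= fejer_sum (walsh e A) (2 ^ A).
Proof.
move=> e1; rewrite fejer_walsh; apply: sumr_ge0 => s _.
by rewrite mulr_ge0 ?exprn_ge0// punctured_ge0.
Qed.

Lemma dirichlet_walsh_ge0 e A :
  (forall i, `|e i| <= 1) -> 0 <= \prod_(k < A) (1 + e k).
Proof. by move=> e1; rewrite -(puncturedA e (leqnn A)) punctured_ge0. Qed.

(** What a binary digit of position [A] may add to a Fejer sum, see [blockE] and
    [fejer_walsh_le]; the extra index [s = A] accounts for the Dirichlet kernel. *)
Definition block e A : R := \sum_(s < A.+1) 2 ^+ s * punctured e A s.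

Lemma blockE e A :
  block e A = fejer_sum (walsh e A) (2 ^ A) + 2 ^+ A * \prod_(k < A) (1 + e k).
Proof. by rewrite /block big_ord_recr/= fejer_walsh puncturedA. Qed.

Lemma block_ge0 e A : (forall i, `|e i| <= 1) -> 0 <= block e A.
Proof.
by move=> e1; apply: sumr_ge0 => s _; rewrite mulr_ge0 ?exprn_ge0// punctured_ge0.
Qed.

(** Peeling off the binary digits of [m] one at a time, each digit [A] costs at
    most one full block, since the tail is bounded by its number of terms. *)
Lemma fejer_walsh_le e A m : (forall i, `|e i| <= 1) -> (m < 2 ^ A)%N ->
  `|fejer_sum (walsh e A) m| <= \sum_(B < A) block e B.
Proof.
move=> e1; elim: A m => [|A IH] m.
  by rewrite expn0 ltnS leqn0 => /eqP ->; rewrite /fejer_sum !big_ord0 normr0.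
rewrite big_ord_recr/= => mA; have [m2|m2] := ltnP m (2 ^ A).
  rewrite (@fejer_sum_ext _ (walsh e A)); last first.
    by move=> i im; apply: walshS; exact: ltn_trans im m2.
  by rewrite -[leLHS]addr0 lerD ?block_ge0// IH.
rewrite -(subnKC m2); set m' := (m - 2 ^ A)%N.
have m'A : (m' < 2 ^ A)%N by rewrite ltn_subLR// addnn -mul2n -expnS.
have P0 := dirichlet_walsh_ge0 A e1; have F0 := fejer_walsh_ge0 A e1.
rewrite (fejer_walshD _ (ltnW m'A)) addrC blockE.
apply: (le_trans (ler_normD _ _)); rewrite normrM lerD//; last first.
  by rewrite -[leRHS]mul1r ler_pM// IH.
rewrite ger0_norm ?addr_ge0 ?mulr_ge0// lerD2l ler_wpM2r//.
by rewrite -natrX ler_nat ltnW.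
Qed.

End fejer_sums.

(** * The Kaczmarz kernel *)

Section kaczmarz_kernel.
Context {R : realType}.
Implicit Types z x t : walsh_group.

Definition reversed N z (k : nat) : R := rademacher R (N - 1 - k) z.

Lemma norm_rademacher k z : `|rademacher R k z| = 1.
Proof. by rewrite /rademacher normrX normrN1 expr1n. Qed.

Lemma kaczmarz_block A m z : (m < 2 ^ A)%N ->
  kaczmarz R (2 ^ A + m) z = rademacher R A z * walsh (reversed A z) A m.
Proof.
move=> mA; rewrite /kaczmarz addn_eq0 expn_eq0/= msb_block//.
by congr (_ * _); apply: eq_bigr => k _; rewrite bit_addl.
Qed.

Lemma prod_reversed A z :
  \prod_(k < A) (1 + reversed A z k) = \prod_(k < A) (1 + rademacher R k z).
Proof.
rewrite [RHS](reindex_inj rev_ord_inj)/=; apply: eq_bigr => k _.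
by rewrite /reversed subnAC subn1 subnS.
Qed.

Lemma dirichlet_kaczmarz A z :
  dirichlet_sum (kaczmarz R ^~ z) (2 ^ A) = \prod_(k < A) (1 + rademacher R k z).
Proof.
elim: A => [|A IH]; first by rewrite /dirichlet_sum expn0 big_ord1 big_ord0.
rewrite expnS mul2n -addnn dirichlet_sumD IH.
rewrite (dirichlet_sum_ext (@kaczmarz_block A ^~ z)).
by rewrite dirichlet_sumZ dirichlet_walsh prod_reversed big_ord_recr/=; ring.
Qed.

Lemma fejer_kaczmarzD A m z : (m <= 2 ^ A)%N ->
  fejer_sum (kaczmarz R ^~ z) (2 ^ A + m) =
  fejer_sum (kaczmarz R ^~ z) (2 ^ A) + m%:R * \prod_(k < A) (1 + rademacher R k z) +
  rademacher R A z * fejer_sum (walsh (reversed A z) A) m.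
Proof.
move=> mA; rewrite fejer_sumD dirichlet_kaczmarz -fejer_sumZ.
congr (_ + _); apply: fejer_sum_ext => i im.
by apply: kaczmarz_block; exact: leq_trans im mA.
Qed.

Lemma norm_reversed N z i : `|reversed N z i| <= 1.
Proof. by rewrite /reversed norm_rademacher. Qed.

Lemma fejer_kaczmarz_pow A z :
  `|fejer_sum (kaczmarz R ^~ z) (2 ^ A)| <= \sum_(B < A) block (reversed B z) B.
Proof.
elim: A => [|A IH].
  by rewrite expn0 /fejer_sum big_ord1 /dirichlet_sum !big_ord0 normr0.
rewrite big_ord_recr/= expnS mul2n -addnn fejer_kaczmarzD// -addrA.
apply: (le_trans (ler_normD _ _)); apply: lerD => //.
have P0 := dirichlet_walsh_ge0 A (norm_reversed A z).
have F0 := fejer_walsh_ge0 A (norm_reversed A z).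
apply: (le_trans (ler_normD _ _)); rewrite [X in _ + X]normrM norm_rademacher mul1r.
by rewrite -prod_reversed natrX !ger0_norm ?mulr_ge0 ?exprn_ge0// blockE addrC.
Qed.

(** The Fejer kernels whose order has leading digit [N] are dominated by one
    non-negative function, which is why the supremum over these orders costs
    nothing. *)
Definition majorant N z : R :=
  \sum_(B < N) block (reversed B z) B + \sum_(A < N.+1) block (reversed N z) A.

Lemma majorant_ge0 N z : 0 <= majorant N z.
Proof.
by apply: addr_ge0; apply: sumr_ge0 => B _; apply: block_ge0; exact: norm_reversed.
Qed.

Lemma fejer_kaczmarz_le N m z : (m < 2 ^ N)%N ->
  `|fejer_sum (kaczmarz R ^~ z) (2 ^ N + m)| <= majorant N z.
Proof.
move=> mN; rewrite (fejer_kaczmarzD _ (ltnW mN)) /majorant big_ord_recr/= -addrA.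
apply: (le_trans (ler_normD _ _)); apply: lerD; first exact: fejer_kaczmarz_pow.
rewrite addrC; apply: (le_trans (ler_normD _ _)); apply: lerD.
  rewrite normrM norm_rademacher mul1r; apply: fejer_walsh_le => //.
  exact: norm_reversed.
have P0 := dirichlet_walsh_ge0 N (norm_reversed N z).
have F0 := fejer_walsh_ge0 N (norm_reversed N z).
rewrite -prod_reversed ger0_norm ?mulr_ge0// blockE -[leLHS]add0r lerD//.
by rewrite ler_wpM2r// -natrX ler_nat ltnW.
Qed.

Lemma rademacher_translate k x t :
  rademacher R k (translate x t) = rademacher R k x * rademacher R k t.
Proof.
by rewrite /rademacher /Defs.coord /translate signr_addb.
Qed.

Lemma kaczmarz_translate i x t :
  kaczmarz R i (translate x t) = kaczmarz R i x * kaczmarz R i t.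
Proof.
rewrite /kaczmarz; case: eqP => _; first by rewrite mul1r.
rewrite rademacher_translate mulrACA -big_split/=; congr (_ * _).
by apply: eq_bigr => k _; rewrite rademacher_translate exprMn.
Qed.

Lemma depends_rademacher k : depends k.+1 (rademacher R k).
Proof. by move=> x y xy; congr (_ ^+ nat_of_bool _); exact: xy. Qed.

Lemma depends_kaczmarz A i : (i < 2 ^ A)%N -> depends A (kaczmarz R i).
Proof.
have [->|] := posnP i; first by move=> _ x y _; rewrite /kaczmarz eqxx.
case/leading_digit => N [m [mN ->]] iA.
have NA : (N < A)%N.
  by rewrite -(ltn_exp2l _ _ (leqnn 2)); apply: leq_ltn_trans iA; exact: leq_addr.
have rA k : (k <= N)%N -> depends A (rademacher R k).
  by move=> kN; apply: depends_le (@depends_rademacher k); exact: leq_ltn_trans kN NA.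
move=> x y xy; rewrite !kaczmarz_block//; congr (_ * _); first exact: rA xy.
by apply: eq_bigr => k _; congr (_ ^+ _); apply: rA xy; rewrite -subnDA leq_subr.
Qed.

End kaczmarz_kernel.

(** * Geometric sums *)

Section geometric_sums.
Context {R : realType}.
Implicit Types x w : R.

Lemma sum_geometric_le x n : 0 <= x < 1 -> \sum_(i < n) x ^+ i <= (1 - x)^-1.
Proof.
move=> /andP[x0 x1]; have x1' : 0 < 1 - x by rewrite subr_gt0.
rewrite -[leRHS]mul1r ler_pdivlMr// mulrC -opprB mulNr -subrX1 opprB.
by rewrite gerBl exprn_ge0.
Qed.

Lemma sum_geometric_gt1 w n : 1 < w -> \sum_(i < n.+1) w ^+ i <= w / (w - 1) * w ^+ n.
Proof.
move=> w1; have w1' : 0 < w - 1 by rewrite subr_gt0.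
rewrite mulrAC -exprS ler_pdivlMr// mulrC -subrX1.
by rewrite gerBl.
Qed.

(** A two-sided geometric sum around [D], each side being at most [(1 - x)^-1]. *)
Lemma sum_geometric_dist x D n : 0 <= x < 1 ->
  \sum_(i < n) x ^+ ((i - D) + (D - i)) <= 2 / (1 - x).
Proof.
move=> x01; have /andP[x0 x1] := x01.
suff : \sum_(i < n) x ^+ ((i - D) + (D - i)) <=
    (1 - x)^-1 + \sum_(k < D) x ^+ k.+1.
  move=> /le_trans; apply; rewrite [leRHS](_ : _ = (1 - x)^-1 + (1 - x)^-1); last by ring.
  rewrite lerD2l; apply: le_trans (sum_geometric_le D x01).
  by apply: ler_sum => k _; rewrite exprSr ler_piMr ?exprn_ge0// ltW.
elim: D n => [|D IH] n.
  rewrite big_ord0 addr0; apply: le_trans (sum_geometric_le n x01).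
  by apply: ler_sum => i _; rewrite subn0 addn0.
case: n => [|n].
  rewrite big_ord0; apply: addr_ge0; first by rewrite invr_ge0 subr_ge0 ltW.
  by apply: sumr_ge0 => k _; rewrite exprn_ge0.
rewrite big_ord_recl [X in _ <= _ + X]big_ord_recr /= addrA addrC.
by apply: lerD => //; exact: IH.
Qed.

End geometric_sums.

(** * Moments of the majorant *)

Section moments.
Context {R : realType}.

(** Coordinates are independent, so that the factors are averaged one by one. *)
Lemma averages_prod (phi : bool -> R) (J K : seq nat) z : uniq J ->
  averages K (fun z => \prod_(j <- J) phi (z j)) z =
  \prod_(j <- J) (if j \in K then (phi false + phi true) / 2 else phi (z j)).
Proof.
move=> uJ; elim: K z => [|k K IH] z /=; first by apply: eq_bigr.
rewrite /average !IH.
have E b : {in [pred j | j != k], forall j,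
    (if j \in K then (phi false + phi true) / 2 else phi (put k b z j)) =
    (if j \in k :: K then (phi false + phi true) / 2 else phi (z j))}.
  by move=> j; rewrite inE => jk; rewrite inE (negbTE jk) /put (negbTE jk).
have [kJ|kJ] := boolP (k \in J).
  rewrite !(bigD1_seq k)//= inE eqxx /put eqxx.
  rewrite (eq_bigr _ (fun j jk => E false j jk)) (eq_bigr _ (fun j jk => E true j jk)).
  by case: (k \in K) => /=; field.
have E' b : \prod_(j <- J)
    (if j \in K then (phi false + phi true) / 2 else phi (put k b z j)) =
    \prod_(j <- J) (if j \in k :: K then (phi false + phi true) / 2 else phi (z j)).
  apply: eq_big_seq => j jJ; apply: E; rewrite inE.
  by apply: contraNneq kJ => <-.
by rewrite !E'; field.
Qed.

Variable p : R.
Hypothesis p_gt0 : 0 < p.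
Hypothesis p_lt : p < 1 / 2.

Let p01 : 0 < p < 1. Proof. by have := p_lt; rewrite p_gt0 => h; apply/andP; split=> //; lra. Qed.

Notation w := (2 `^ p).
Notation th := (w ^+ 2 / 2).

Lemma two_powR_gt1 : 1 < w.
Proof.
rewrite -[ltLHS](powRr0 2) /powR pnatr_eq0/= mul0r ltr_expR mulr_gt0//.
by rewrite ln_gt0// ltr1n.
Qed.

Lemma two_powR_gt0 : 0 < w. Proof. exact: lt_trans two_powR_gt1. Qed.

Lemma two_powR_sqr_lt2 : w ^+ 2 < 2.
Proof.
rewrite -powR_mulrn ?powR_ge0// -powRrM -[ltRHS]powRr1// /powR pnatr_eq0/=.
have h := p_lt; by rewrite ltr_expR ltr_pM2r ?ln_gt0 ?ltr1n//; lra.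
Qed.

Lemma two_powR_lt2 : w < 2.
Proof.
by apply: lt_trans two_powR_sqr_lt2; rewrite expr2 ltr_pMr ?two_powR_gt1 ?two_powR_gt0.
Qed.

Lemma th_itv01 : 0 <= th < 1.
Proof. by rewrite divr_ge0 ?exprn_ge0 ?powR_ge0//= ltr_pdivrMr// mul1r two_powR_sqr_lt2. Qed.

Lemma powR_exp_two n : (2 ^+ n) `^ p = w ^+ n.
Proof.
rewrite -(powR_mulrn n (powR_ge0 2 p)) -(powR_mulrn n (ler0n R 2)).
by rewrite -powRrM mulrC powRrM.
Qed.

(** The coordinates that occur in [punctured (reversed B z) A s]. *)
Definition pattern B A s : seq nat :=
  [seq (B - 1 - i)%N | i <- index_iota 0 A & i != s].

Lemma uniq_pattern B A s : (A <= B)%N -> uniq (pattern B A s).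
Proof.
move=> AB; rewrite map_inj_in_uniq ?filter_uniq ?iota_uniq// => i j.
by rewrite !mem_filter !mem_index_iota => /and3P[_ _ iA] /and3P[_ _ jA]; lia.
Qed.

Lemma punctured_pattern B A s z :
  punctured (reversed B z : nat -> R) A s =
  \prod_(j <- pattern B A s) (1 + (-1) ^+ (z j : bool)).
Proof. by rewrite /punctured /pattern big_map big_filter. Qed.

Lemma count_geq_iota c n : count (fun i => (c <= i)%N) (iota 0 n) = (n - c)%N.
Proof.
elim: n => // n IH; rewrite -addn1 iotaD count_cat IH/= add0n.
by case: leqP; lia.
Qed.

Lemma count_pattern B A s M : (A <= B)%N ->
  (A - (B - M) - 1 <= count (fun j => (j < M)%N) (pattern B A s))%N.
Proof.
move=> AB; rewrite count_map count_filter /index_iota subn0.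
rewrite -{1}(count_geq_iota (B - M) A) leq_subLR addnC.
have := count_predC (pred1 s) [seq i <- iota 0 A | (B - M <= i)%N].
rewrite !count_filter size_filter => <-; rewrite addnC; apply: leq_add.
  rewrite leq_eqVlt; apply/orP; left; apply/eqP/eq_in_count => i.
  by rewrite mem_iota/= => iA; rewrite andbC; congr (_ && _); lia.
apply: leq_trans (_ : count_mem s (iota 0 A) <= 1)%N.
  by apply: sub_count => i /andP[].
by rewrite count_uniq_mem ?iota_uniq// leq_b1.
Qed.

Notation moment L M f x :=
  (averages (iota 0 L) (fun z => averages (iota M (L - M)) f z `^ p) x).

Lemma addr_sign_ge0 (b : bool) : 0 <= 1 + (-1) ^+ b :> R.
Proof. by case: b; rewrite ?expr1 ?expr0; lra. Qed.

(** Conditioning on [F_M] replaces the factors of index at least [M] by their mean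
    1; each of the remaining ones, at least [A - (B - M) - 1] in number, has a
    [p]-th moment [w / 2]. *)
Lemma moment_punctured L M B A s x : (A <= B)%N -> (B <= L)%N -> (M <= L)%N ->
  moment L M (fun z => punctured (reversed B z) A s) x <=
  2 / w * (w / 2) ^+ (A - (B - M)).
Proof.
move=> AB BL ML.
have pL j : j \in pattern B A s -> (j < L)%N.
  case/mapP => i; rewrite mem_filter mem_index_iota => /and3P[_ _ iA] ->.
  by lia.
have ph0 := addr_sign_ge0.
pose K := [seq j <- pattern B A s | (j < M)%N].
have uK : uniq K by rewrite filter_uniq// uniq_pattern.
have -> : (fun z => averages (iota M (L - M))
      (fun z => punctured (reversed B z) A s) z `^ p) =
    (fun z : walsh_group => \prod_(j <- K) (1 + (-1) ^+ (z j : bool)) `^ p).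
  apply/funext => z.
  rewrite (_ : (fun z => punctured (reversed B z) A s) = (fun z : walsh_group =>
    \prod_(j <- pattern B A s) (1 + (-1) ^+ (z j : bool)))); last first.
    by apply/funext => y; rewrite punctured_pattern.
  rewrite (averages_prod (fun b : bool => 1 + (-1) ^+ b)) ?uniq_pattern//.
  rewrite expr0 expr1.
  rewrite (_ : (_ + _) / 2 = 1 :> R); last by field.
  rewrite (bigID (fun j => (j < M)%N))/= [X in _ * X]big1_seq; last first.
    by move=> j /andP[jM /pL jL]; rewrite mem_iota ifT//; lia.
  rewrite mulr1 -big_filter -/K.
  have : all (fun j => (j < M)%N) K by rewrite filter_all.
  elim: K {uK} => [|k K IH] /=; first by rewrite !big_nil powR1.
  case/andP=> kM /IH {}IH; rewrite !big_cons mem_iota ifF; last by lia.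
  rewrite powRM// ?IH//; apply: prodr_ge0 => j _.
  by case: ifP.
rewrite (averages_prod (fun b : bool => (1 + (-1) ^+ b) `^ p))//.
rewrite expr0 expr1 subrr powR0 ?gt_eqF// addr0.
rewrite (eq_big_seq (fun=> w / 2)); last first.
  move=> j; rewrite mem_filter => /andP[_ /pL jL].
  by rewrite mem_iota/= add0n jL (_ : 1 + 1 = 2 :> R).
rewrite big_const_seq count_predT iter_mulr_1.
have w20 : 0 <= w / 2 by rewrite divr_ge0// powR_ge0.
have w21 : w / 2 <= 1 by rewrite ler_pdivrMr// mul1r ltW// two_powR_lt2.
apply: (@le_trans _ _ ((w / 2) ^+ (A - (B - M) - 1))).
  by apply: ler_wiXn2l => //; rewrite size_filter count_pattern.
case: (A - (B - M))%N => [|c].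
  by rewrite sub0n expr0 mulr1 ler_pdivlMr ?two_powR_gt0// mul1r ltW// two_powR_lt2.
rewrite subn1/= exprS mulrA [2 / w * _](_ : _ = 1) ?mul1r//.
by field; rewrite gt_eqF// two_powR_gt0.
Qed.

Lemma moment_sum (I : Type) (r : seq I) (f : I -> walsh_group -> R) (C : I -> R)
    L M x :
  (forall i z, 0 <= f i z) ->
  (forall i, moment L M (f i) x <= C i) ->
  moment L M (fun z => \sum_(i <- r) f i z) x <= \sum_(i <- r) C i.
Proof.
move=> f0 fC; apply: (@le_trans _ _ (\sum_(i <- r) moment L M (f i) x)); last first.
  by apply: ler_sum => i _; exact: fC.
rewrite -averages_sum; apply: ler_averages => z; rewrite averages_sum.
by apply: powR_sum => // i; exact: averages_ge0.
Qed.

Lemma moment_block L M B A x : (A <= B)%N -> (B <= L)%N -> (M <= L)%N ->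
  moment L M (fun z => block (reversed B z) A) x <=
  2 / (w - 1) * (w ^+ A * (w / 2) ^+ (A - (B - M))).
Proof.
move=> AB BL ML; have w0 := two_powR_gt0; have w1 := two_powR_gt1.
have e1 := @norm_reversed R B.
rewrite /block; apply: (le_trans (@moment_sum _ _ _
  (fun s : 'I_A.+1 => w ^+ s * (2 / w * (w / 2) ^+ (A - (B - M)))) _ _ _ _ _)).
- by move=> s z; rewrite mulr_ge0 ?exprn_ge0// punctured_ge0.
- move=> s; apply: le_trans (_ : _ <= w ^+ s *
    moment L M (fun z => punctured (reversed B z) A s) x) _; last first.
    by rewrite ler_pM2l ?exprn_gt0// moment_punctured.
  rewrite -averagesZ; apply: ler_averages => z; rewrite averagesZ powRM.
  + by rewrite powR_exp_two.
  + by rewrite exprn_ge0.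
  + by apply: averages_ge0 => y; rewrite punctured_ge0.
rewrite -mulr_suml.
have q0 : 0 <= 2 / w * (w / 2) ^+ (A - (B - M)).
  by rewrite !mulr_ge0 ?exprn_ge0// ?divr_ge0 ?invr_ge0 ?ltW.
apply: le_trans (ler_wpM2r q0 (sum_geometric_gt1 A w1)) _.
by rewrite le_eqVlt; apply/orP; left; apply/eqP; field; rewrite subr_eq0 !gt_eqF.
Qed.

(** The orders of magnitude met in the majorant grow geometrically up to
    [N - M] and decay geometrically after it, or away from both ends [0] and [N];
    hence only the peak [w ^ (N - M)] counts. *)
Lemma moment_majorant : exists2 C : R, 0 < C & forall L M N x,
  (M <= N)%N -> (N <= L)%N ->
  moment L M (majorant N) x <= C * w ^+ (N - M).
Proof.
have w0 := two_powR_gt0; have w1 := two_powR_gt1; have w2 := two_powR_lt2.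
have [th0 th1] := andP th_itv01.
(* rate at which the terms decay away from their peak *)
pose q := Num.max w^-1 th.
have q01 : 0 <= q < 1 by apply/andP; split; rewrite ?le_max ?th0 ?orbT// gt_max th1 invf_lt1 ?w1.
have [q0 q1] := andP q01.
have q1' : 0 < 1 - q by rewrite subr_gt0.
have wq : w^-1 <= q by rewrite le_max lexx.
have thq : th <= q by rewrite le_max lexx orbT.
have wi n : w^-1 ^+ n <= q ^+ n by rewrite lerXn2r// ?nnegrE ?invr_ge0 ?ltW.
have thi n : th ^+ n <= q ^+ n by rewrite lerXn2r// ?nnegrE.
pose c := 2 / (w - 1); have c0 : 0 < c by rewrite divr_gt0// subr_gt0.
exists (c * (2 / (1 - q)) + c * (2 / (1 - q))) => [|L M N x MN NL].
  by rewrite addr_gt0// mulr_gt0// divr_gt0.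
set D := (N - M)%N.
have e1 := @norm_reversed R.
have s10 z : 0 <= \sum_(B < N) block (reversed B z : nat -> R) B.
  by apply: sumr_ge0 => B _; exact: block_ge0.
have s20 z : 0 <= \sum_(A < N.+1) block (reversed N z : nat -> R) A.
  by apply: sumr_ge0 => B _; exact: block_ge0.
rewrite /majorant.
apply: (@le_trans _ _ (moment L M (fun z => \sum_(B < N) block (reversed B z) B) x +
    moment L M (fun z => \sum_(A < N.+1) block (reversed N z) A) x)).
  rewrite -averagesD; apply: ler_averages => z; rewrite averagesD.
  by apply: powR_subadditive => //; exact: averages_ge0.
rewrite mulrDl; apply: lerD.
- apply: le_trans (_ : _ <= \sum_(B < N) c * (w ^+ D * (q ^+ B + q ^+ (N - B)))) _.
    apply: moment_sum => [B z|B]; first exact: block_ge0.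
    have BN : (B < N)%N by [].
    apply: le_trans (moment_block x (leqnn B) (leq_trans (ltnW BN) NL) (leq_trans MN NL)) _.
    rewrite ler_pM2l//; have [BM|BM] := leqP B M.
      have /eqP-> : (B - M == 0)%N by rewrite subn_eq0.
      rewrite subn0.
      rewrite -exprMn mulrA -expr2; apply: le_trans (thi B) _.
      rewrite -[leLHS]mul1r ler_pM ?exprn_ge0// ?exprn_ege1 ?(ltW w1)//.
      by rewrite lerDl exprn_ge0.
    rewrite subKn ?(ltnW BM)//.
    apply: le_trans (_ : _ <= w ^+ D * w^-1 ^+ (N - B)) _; last first.
      by rewrite ler_pM2l ?exprn_gt0// (le_trans (wi _))// lerDr exprn_ge0.
    rewrite (_ : D = (B - M) + (N - B))%N; last first.
      by rewrite addnC addnBA ?subnK// ltnW.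
    rewrite exprD -mulrA -exprMn divff ?gt_eqF// expr1n mulr1.
    rewrite -{1}(subnK (ltnW BM)) exprD -mulrA -exprMn mulrA -expr2.
    by rewrite ler_piMr ?exprn_ge0 ?(ltW w0)// exprn_ile1// ltW.
  rewrite -mulr_sumr -[leRHS]mulrA ler_pM2l// -mulr_sumr mulrC ler_pM2r ?exprn_gt0//.
  rewrite big_split/= mulrDl mul1r lerD// ?sum_geometric_le//.
  apply: le_trans (_ : _ <= \sum_(B < N) q ^+ B) _; last exact: sum_geometric_le.
  rewrite [leRHS](reindex_inj rev_ord_inj)/=; apply: ler_sum => B _.
  by apply: ler_wiXn2l => //; [exact: ltW|exact: leq_sub2l].
- apply: le_trans (_ : _ <= \sum_(A < N.+1) c * (w ^+ D * q ^+ ((A - D) + (D - A)))) _.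
    apply: moment_sum => [B z|A]; first exact: block_ge0.
    have AN : (A <= N)%N by rewrite -ltnS.
    apply: le_trans (moment_block x AN NL (leq_trans MN NL)) _.
    rewrite ler_pM2l// -/D; have [AD|AD] := leqP A D.
      have /eqP-> : (A - D == 0)%N by rewrite subn_eq0.
      rewrite expr0 mulr1 add0n.
      apply: le_trans (_ : _ <= w ^+ D * w^-1 ^+ (D - A)) _; last first.
        by rewrite ler_pM2l ?exprn_gt0.
      by rewrite -{1}(subnKC AD) exprD -mulrA -exprMn divff ?gt_eqF// expr1n mulr1.
    have /eqP-> : (D - A == 0)%N by rewrite subn_eq0 ltnW.
    rewrite addn0.
    rewrite -{1}(subnKC (ltnW AD)) exprD -mulrA -exprMn mulrA -expr2.
    by rewrite ler_pM2l ?exprn_gt0.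
  rewrite -mulr_sumr -[leRHS]mulrA ler_pM2l// -mulr_sumr mulrC ler_pM2r ?exprn_gt0//.
  exact: sum_geometric_dist.
Qed.

End moments.

(** * Atoms *)

Section atoms.
Context {R : realType}.
Variable p : R.
Hypothesis p_gt0 : 0 < p.
Hypothesis p_lt : p < 1 / 2.
Variable o : walsh_group.
Implicit Types (g h W b : walsh_group -> R).

Let p01 : 0 < p < 1.
Proof. by have := p_lt; rewrite p_gt0 => h; apply/andP; split=> //; lra. Qed.

Notation w := (2 `^ p).
Notation th := (w ^+ 2 / 2).
Let w0 : 0 < w := two_powR_gt0 p_gt0.

(** The base point [o] fills the coordinates beyond [L]; the value depends on it
    only when [g] depends on more than [L] digits. *)
Definition mean L g : R := averages (iota 0 L) g o.

Lemma ler_mean L g h : (forall x, g x <= h x) -> mean L g <= mean L h.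
Proof. exact: ler_averages. Qed.

Lemma mean_ge0 L g : (forall x, 0 <= g x) -> 0 <= mean L g.
Proof. exact: averages_ge0. Qed.

Lemma mean_sum (I : Type) (r : seq I) (P : pred I) L (g : I -> _ -> R) :
  mean L (fun y => \sum_(i <- r | P i) g i y) = \sum_(i <- r | P i) mean L (g i).
Proof. exact: averages_sum. Qed.

Lemma meanZ L c g : mean L (fun y => c * g y) = c * mean L g.
Proof. exact: averagesZ. Qed.

Definition convolution L g W x : R := mean L (fun t => g t * W (translate x t)).

(** A function that only sees the first [M] digits also sees [W] only through
    its conditional expectation, so that only [M] coordinates pay for the failure
    of Minkowski's inequality. *)
Lemma powR_convolution L M h W C : (M <= L)%N -> depends M h ->
  (forall x, 0 <= h x) -> (forall x, 0 <= W x) ->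
  (forall x, averages (iota 0 L)
     (fun z => averages (iota M (L - M)) W z `^ p) x <= C) ->
  mean L (fun x => convolution L h W x `^ p) <=
  (2 / w) ^+ M * (C * mean L (fun t => h t `^ p)).
Proof.
move=> ML hM h0 W0 WC; set E := averages (iota M (L - M)) W.
have E0 z : 0 <= E z by exact: averages_ge0.
have convE x : convolution L h W x =
    averages (iota 0 M) (fun t => h t * E (translate x t)) o.
  rewrite /convolution /mean -{1}(subnKC ML) iotaD averages_cat add0n.
  congr (averages _ _ _); apply/funext => t; rewrite averages_invarM.
    by rewrite averages_translate.
  by move=> k c y; rewrite mem_iota => /andP[Mk _]; exact: depends_put hM Mk.
apply: (@le_trans _ _ ((2 / w) ^+ M * mean L (fun x =>
    averages (iota 0 M) (fun t => h t `^ p * E (translate x t) `^ p) o))).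
  rewrite -meanZ; apply: ler_mean => x; rewrite convE.
  have := powR_averages p01 (iota 0 M) o (g := fun t => h t * E (translate x t)).
  rewrite size_iota => H; apply: le_trans (H _) _; first by move=> y; rewrite mulr_ge0.
  rewrite ler_pM2l ?exprn_gt0 ?divr_gt0//; apply: ler_averages => t.
  by rewrite powRM.
rewrite ler_pM2l ?exprn_gt0 ?divr_gt0//.
have hpM : depends M (fun t => h t `^ p) by move=> x y xy; rewrite (hM x y).
rewrite /mean averages_exchange (averages_iota_depends hpM ML) -averagesZ.
apply: ler_averages => t; rewrite averagesZ mulrC ler_wpM2r ?powR_ge0//.
rewrite (_ : (fun x => _) = (fun x => E (translate t x) `^ p)).
  by rewrite (averages_translate _ (fun z => E z `^ p)).
by apply/funext => x; rewrite translateC.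
Qed.

(** The Fejer mean of order [n] in kernel form, before division by [n]. *)
Definition fejer L n g x : R :=
  convolution L g (fun z => fejer_sum (kaczmarz R ^~ z) n) x.

Lemma depends_fejer_sum M n : (n <= 2 ^ M)%N ->
  depends M (fun z => fejer_sum (kaczmarz R ^~ z) n).
Proof.
move=> nM x y xy; apply: fejer_sum_ext => i ni.
by apply: depends_kaczmarz xy; exact: leq_trans ni nM.
Qed.

Lemma fejer_sum_pieces (I : Type) (r : seq I) L n (b : I -> _ -> R) x :
  fejer L n (fun t => \sum_(i <- r) b i t) x = \sum_(i <- r) fejer L n (b i) x.
Proof.
rewrite /fejer /convolution -mean_sum; congr mean; apply/funext => t.
by rewrite mulr_suml.
Qed.

(** Atoms are not localized to a single dyadic interval: a bound [h] of level [M]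
    handles at once all those of order [M].  No cancellation is asked for at scale
    [0], since cancellation only serves to discard the levels [N < M]. *)
Definition atom L M h b : Prop :=
  [/\ (M <= L)%N, depends M h, (forall x, `|b x| <= h x) &
      M = 0%N \/ forall x, averages (iota M (L - M)) b x = 0].

Lemma fejer_atom_le L M h b N m x : atom L M h b -> (m < 2 ^ N)%N ->
  `|fejer L (2 ^ N + m) b x| <=
  if (M <= N)%N then convolution L h (majorant N) x else 0.
Proof.
move=> [ML hM bh canc] mN; case: leqP => [_|NM].
  apply: (le_trans (ler_norm_averages _ _ _)); apply: ler_averages => t.
  by rewrite normrM ler_pM// fejer_kaczmarz_le.
case: canc => [M0|canc]; first by rewrite M0 in NM.
rewrite /fejer /convolution /mean -{1}(subnKC ML) iotaD averages_cat add0n.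
rewrite (_ : averages (iota M _) _ = fun=> 0) ?averages_cst ?normr0//.
apply/funext => t.
pose K t := fejer_sum (kaczmarz R ^~ (translate x t)) (2 ^ N + m).
rewrite (_ : (fun t => _) = (fun t => K t * b t)); last first.
  by apply/funext => y; rewrite mulrC.
rewrite averages_invarM ?canc ?mulr0// => k c y.
rewrite mem_iota => /andP[Mk _]; apply: depends_put Mk.
apply: (depends_translate x (depends_fejer_sum _)).
apply: (@leq_trans (2 ^ N.+1)); last by rewrite leq_pexp2l.
by rewrite expnS mul2n -addnn leq_add2l ltnW.
Qed.

Definition weighted L n g x : R :=
  `|n%:R^-1 * fejer L n g x| / (n.+1%:R `^ (p^-1 - 2)).

(** The [p]-th power of [2 ^ N] times the weight at [2 ^ N] is [(w / th) ^ N]. *)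
Lemma weighted_le L N m g x (S : R) : (m < 2 ^ N)%N ->
  `|fejer L (2 ^ N + m) g x| <= S ->
  weighted L (2 ^ N + m) g x `^ p <= (th / w) ^+ N * S `^ p.
Proof.
move=> mN FS; have S0 := le_trans (normr_ge0 _) FS.
have e0 : 0 <= p^-1 - 2.
  have := p_lt; rewrite subr_ge0 -[2]invrK lef_pV2 ?posrE ?invr_gt0// => h.
  by apply: ltW; rewrite -[2^-1]mul1r.
have n0 : 0 < (2 ^ N + m)%:R :> R by rewrite ltr0n addn_gt0 expn_gt0.
have nN : 2 ^+ N <= (2 ^ N + m)%:R :> R by rewrite -natrX ler_nat leq_addr.
apply: (@le_trans _ _ (((2 ^+ N)^-1 * S / (2 ^+ N) `^ (p^-1 - 2)) `^ p)).
  apply: ge0_ler_powR; rewrite ?nnegrE; first exact: ltW.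
  - by rewrite divr_ge0// powR_ge0.
  - by rewrite divr_ge0 ?powR_ge0// mulr_ge0// invr_ge0 exprn_ge0.
  rewrite /weighted normrM (@ger0_norm _ (_%:R^-1)) ?invr_ge0 ?ler0n//.
  apply: ler_pM; rewrite ?mulr_ge0 ?invr_ge0 ?powR_ge0 ?ler0n//.
    apply: ler_pM => //.
    by rewrite lef_pV2 ?posrE ?exprn_gt0.
  rewrite lef_pV2 ?posrE ?powR_gt0 ?exprn_gt0//.
  apply: ge0_ler_powR => //; rewrite ?nnegrE ?exprn_ge0 ?ler0n//.
  by rewrite (le_trans nN)// ler_nat.
have powRV (y : R) : 0 <= y -> y^-1 `^ p = (y `^ p)^-1.
  by move=> y0; rewrite -powR_inv1// powRAC powR_inv1 ?powR_ge0.
have Q : ((2 ^+ N) `^ (p^-1 - 2)) `^ p = 2 ^+ N * (w ^+ N)^-1 * (w ^+ N)^-1.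
  have x0 : (2 ^+ N != 0 :> R) by rewrite expf_neq0.
  rewrite -powRrM (_ : (p^-1 - 2) * p = 1 - p - p); last by field; rewrite gt_eqF.
  rewrite powRD ?x0 ?implybT// powRD ?x0 ?implybT// powRr1 ?exprn_ge0//.
  by rewrite powRN powR_exp_two.
have SN : 0 <= (2 ^+ N)^-1 * S by rewrite mulr_ge0// invr_ge0 exprn_ge0.
rewrite powRM ?invr_ge0 ?powR_ge0// powRM ?invr_ge0 ?exprn_ge0//.
rewrite !powRV ?powR_ge0 ?exprn_ge0// Q powR_exp_two !expr_div_n -exprM mul2n -addnn exprD.
have : w ^+ N != 0 by rewrite expf_neq0// gt_eqF.
have : 2 ^+ N != 0 :> R by rewrite expf_neq0.
move: (w ^+ N) (2 ^+ N) => a c c0 a0; rewrite le_eqVlt; apply/orP; left; apply/eqP.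
by field; rewrite a0.
Qed.

(** The central estimate: a sum of atoms is controlled in [H_p] fashion by the
    sum of the [p]-th powers of their bounds.  At level [N] an atom at scale
    [M <= N] contributes [th ^ (N - M)] of it, which is summable. *)
Lemma atoms_bound : exists2 C : R, 0 < C & forall (I : Type) (r : seq I) L
  (M : I -> nat) (h b : I -> walsh_group -> R),
  (forall i, atom L (M i) (h i) (b i)) ->
  exists G : walsh_group -> R,
    [/\ forall x, 0 <= G x,
      forall n x, (0 < n)%N -> (n < 2 ^ L)%N ->
        weighted L n (fun t => \sum_(i <- r) b i t) x `^ p <= G x &
    mean L G <= C * \sum_(i <- r) mean L (fun t => h i t `^ p)].
Proof.
have [th0 th1] := andP (th_itv01 p_lt).
have [C C0 HC] := moment_majorant p_gt0 p_lt.
exists (C * (2 / (1 - th))) => [|I r L M h b at_b].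
  by rewrite mulr_gt0// divr_gt0// subr_gt0.
have ML i : (M i <= L)%N by case: (at_b i).
have h0 i x : 0 <= h i x.
  by case: (at_b i) => _ _ bh _; exact: le_trans (normr_ge0 _) (bh x).
have conv0 i N x : 0 <= convolution L (h i) (majorant N) x.
  by apply: mean_ge0 => t; rewrite mulr_ge0// majorant_ge0.
pose S N x := \sum_(i <- r | (M i <= N)%N) convolution L (h i) (majorant N) x.
(* the cost of the normalisation and of the weight at level N is q ^ N *)
pose q := th / w; have q0 : 0 <= q by rewrite divr_ge0// ltW.
exists (fun x => \sum_(N < L) q ^+ N * S N x `^ p); split=> [x|n x n0 nL|].
- by apply: sumr_ge0 => N _; rewrite mulr_ge0 ?exprn_ge0 ?powR_ge0.
- have [N [m [mN nE]]] := leading_digit n0.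
  have NL : (N < L)%N.
    rewrite -(ltn_exp2l _ _ (leqnn 2)); apply: leq_ltn_trans nL.
    by rewrite nE leq_addr.
  rewrite (bigD1 (Ordinal NL))//= -[leLHS]addr0; apply: lerD; last first.
    by apply: sumr_ge0 => i _; rewrite mulr_ge0 ?exprn_ge0 ?powR_ge0.
  rewrite nE; apply: weighted_le => //; rewrite fejer_sum_pieces.
  apply: (le_trans (ler_norm_sum _ _ _)); rewrite /S [leRHS]big_mkcond/=.
  by apply: ler_sum => i _; exact: fejer_atom_le.
rewrite mean_sum.
apply: (@le_trans _ _ (\sum_(N < L) \sum_(i <- r | (M i <= N)%N)
    th ^+ (N - M i) * (C * mean L (fun t => h i t `^ p)))).
  apply: ler_sum => N _; rewrite meanZ.
  apply: le_trans (_ : _ <= q ^+ N * \sum_(i <- r | (M i <= N)%N)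
      mean L (fun x => convolution L (h i) (majorant N) x `^ p)) _.
    rewrite ler_wpM2l ?exprn_ge0// -mean_sum; apply: ler_mean => x.
    exact: powR_sum.
  rewrite mulr_sumr; apply: ler_sum => i MN.
  have [_ hM _ _] := at_b i.
  apply: le_trans (ler_wpM2l _ (powR_convolution (C := C * w ^+ (N - M i))
    (ML i) hM (h0 i) (@majorant_ge0 R N) _)) _; first by rewrite exprn_ge0.
    by move=> x; apply: HC => //; exact: ltnW.
  rewrite le_eqVlt; apply/orP; left; apply/eqP.
  have thM : th ^+ M i = w ^+ M i * w ^+ M i / 2 ^+ M i.
    by rewrite expr_div_n -exprM mul2n -addnn exprD.
  rewrite -{1}(subnK MN) /q exprD.
  rewrite ![(th / w) ^+ _]expr_div_n thM [(2 / w) ^+ _]expr_div_n.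
  have wd k : w ^+ k != 0 by rewrite expf_neq0// gt_eqF.
  have td : 2 ^+ M i != 0 :> R by rewrite expf_neq0.
  move: (wd (M i)) (wd (N - M i)%N) td.
  move: (w ^+ M i) (w ^+ (N - M i)) (2 ^+ M i) (th ^+ _) (mean L _) => a c e f g.
  by move=> a0 c0 e0; field; rewrite a0 c0 e0.
rewrite (exchange_big_dep xpredT)//= mulr_sumr; apply: ler_sum => i _.
rewrite -mulr_suml mulrA ler_wpM2r//.
  by apply: mean_ge0 => t; exact: powR_ge0.
rewrite mulrC ler_pM2l// big_mkcond/=.
apply: le_trans (sum_geometric_dist (M i) L (th_itv01 p_lt)).
apply: ler_sum => N _; case: leqP => [MN|_]; last by rewrite exprn_ge0.
have /eqP-> : (M i - N == 0)%N by rewrite subn_eq0.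
by rewrite addn0.
Qed.

End atoms.

(** * Stopping a dyadic martingale *)

Section stopping.
Context {R : realType}.
Variable f : nat -> walsh_group -> R.
Hypothesis depends_f : forall n, depends n (f n).
Hypothesis average_f : forall n, average n (f n.+1) = f n.
Implicit Types (lam : R) (n L M : nat) (x : walsh_group).

(** Stage [n] is declared bad as soon as one of the two siblings exceeds [lam],
    so that badness of stage [n.+1] is already decided by the first [n] digits. *)
Definition bad lam n x : bool :=
  if n is m.+1 then (lam < `|f n (put m false x)|) || (lam < `|f n (put m true x)|)
  else lam < `|f 0%N x|.

Fixpoint alive lam n x : bool :=
  (if n is m.+1 then alive lam m x else true) && ~~ bad lam n x.

Fixpoint stopped lam n x : R :=
  if alive lam n x then f n x else if n is m.+1 then stopped lam m x else 0.

Definition first_bad lam n x : bool :=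
  (if n is m.+1 then alive lam m x else true) && bad lam n x.

Lemma depends_bad lam n : depends n.-1 (bad lam n).
Proof.
case: n => [|n] x y xy /=; first by rewrite (depends_f xy).
by congr (_ || _); congr (_ < `| _ |); apply: (depends_put_eq _ (@depends_f _)).
Qed.

Lemma depends_alive lam n : depends n.-1 (alive lam n).
Proof.
elim: n => [|n IH] x y xy /=; first by rewrite (depends_f xy).
congr (_ && ~~ _); last exact: (@depends_bad lam n.+1).
exact: (depends_le (leq_pred n) IH).
Qed.

Lemma depends_first_bad lam n : depends n.-1 (first_bad lam n).
Proof.
move=> x y xy; rewrite /first_bad (@depends_bad _ _ _ _ xy); congr (_ && _).
by case: n xy => //= n xy; exact: (depends_le (leq_pred n) (@depends_alive lam n)).
Qed.

Lemma bad_self lam n x : ~~ bad lam n x -> `|f n x| <= lam.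
Proof.
case: n => [|n] /=; first by rewrite -leNgt.
rewrite negb_or -!leNgt -{3}(put_id n x) => /andP[].
by case: (x n).
Qed.

Lemma alive_norm lam n x : alive lam n x -> `|f n x| <= lam.
Proof. by case: n => [|n] /andP[_]; exact: bad_self. Qed.

Lemma stopped_norm lam n x : 0 <= lam -> `|stopped lam n x| <= lam.
Proof.
move=> l0; elim: n => [|n IH].
  by rewrite /=; case: ifP => [|_]; [exact: (@alive_norm lam 0%N)|rewrite normr0].
by rewrite [stopped _ _ _]/=; case: ifP => // a; exact: (@alive_norm lam n.+1).
Qed.

Lemma alive_stopped lam n x : alive lam n x -> stopped lam n x = f n x.
Proof. by case: n => [|n] /= ->. Qed.

Lemma alive_le lam lam' n x : lam <= lam' -> alive lam n x -> alive lam' n x.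
Proof.
move=> ll; have H m : ~~ bad lam m x -> ~~ bad lam' m x.
  case: m => [|m] /=; rewrite ?negb_or -!leNgt; first by move/le_trans; exact.
  by move=> /andP[/le_trans -> // /le_trans ->].
by elim: n => [|n IH] /=; [exact: (H 0%N)|move=> /andP[/IH -> /(H n.+1)]].
Qed.

Lemma stoppedS lam n x : stopped lam n.+1 x =
  if alive lam n.+1 x then f n.+1 x else stopped lam n x.
Proof. by []. Qed.

Lemma depends_stopped lam n : depends n (stopped lam n).
Proof.
elim: n => [|n IH] x y xy; first by rewrite /= (depends_f xy).
have xy' i : (i < n)%N -> x i = y i by move=> h; exact: xy i (leqW h).
rewrite !stoppedS (depends_f xy) (IH x y xy').
by rewrite (@depends_alive lam n.+1 x y xy').
Qed.

(** Stopping is a martingale transform: the decision to follow [f] from stage [n]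
    to stage [n.+1] depends on the first [n] digits only. *)
Lemma average_stopped lam n : average n (stopped lam n.+1) = stopped lam n.
Proof.
apply/funext => x; rewrite /average.
have an b : alive lam n.+1 (put n b x) = alive lam n.+1 x.
  exact: (depends_put _ _ (@depends_alive lam n.+1) (leqnn n)).
have sn b : stopped lam n (put n b x) = stopped lam n x.
  exact: (depends_put _ _ (@depends_stopped lam n) (leqnn n)).
rewrite !stoppedS !an !sn; case: ifP => [a|_]; last by field.
rewrite alive_stopped; last by case/andP: a.
by rewrite -[in RHS]average_f.
Qed.

Lemma averages_stopped lam M L : (M <= L)%N ->
  averages (iota M (L - M)) (stopped lam L) = stopped lam M.
Proof.
move=> ML; rewrite -{2}(subnKC ML); move: (L - M)%N {ML} => d.
elim: d M => [|d IH] M.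
  by rewrite addn0.
by rewrite /= -addSnnS IH average_stopped.
Qed.

Definition piece lam lam' L n x : R :=
  (first_bad lam n x)%:R * (stopped lam' L x - stopped lam L x).

Lemma sum_first_bad lam L x : \sum_(n < L.+1) (first_bad lam n x)%:R = (~~ alive lam L x)%:R :> R.
Proof.
elim: L => [|L IH]; first by rewrite big_ord1 /first_bad /= negbK.
rewrite big_ord_recr/= IH /first_bad /=.
by case: (alive lam L x) => /=; rewrite ?negbK ?add0r ?addr0.
Qed.

Lemma sum_piece lam lam' L x : lam <= lam' ->
  \sum_(n < L.+1) piece lam lam' L n x = stopped lam' L x - stopped lam L x.
Proof.
move=> ll; rewrite -mulr_suml sum_first_bad.
have [a|] := boolP (alive lam L x); last by rewrite mul1r.
by rewrite !alive_stopped ?(alive_le ll)// subrr mulr0.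
Qed.

Lemma atom_piece lam lam' L n : 0 <= lam -> lam <= lam' -> (n <= L)%N ->
  atom L n.-1 (fun x => (lam + lam') * (first_bad lam n x)%:R) (piece lam lam' L n).
Proof.
move=> l0 ll nL; split.
- exact: leq_trans (leq_pred n) nL.
- by move=> x y xy; rewrite (@depends_first_bad lam n x y xy).
- move=> x; rewrite normrM mulrC normr_nat ler_wpM2r//.
  apply: (le_trans (ler_normB _ _)); rewrite addrC.
  by apply: lerD; apply: stopped_norm => //; exact: le_trans ll.
case: n nL => [|n] nL; [by left|right => x].
rewrite averages_invarM => [|k c y]; last first.
  rewrite mem_iota => /andP[nk _]; congr (_%:R).
  by rewrite (depends_put _ _ (@depends_first_bad lam n.+1) nk).
rewrite (_ : (fun y => _) = (fun y => stopped lam' L y + -1 * stopped lam L y)).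
  rewrite averagesD averagesZ !averages_stopped ?(ltnW nL)//.
  rewrite /first_bad; case: (boolP (alive lam n x)) => [a|]; last by rewrite mul0r.
  by rewrite !alive_stopped ?(alive_le ll)//; ring.
by apply/funext => y; rewrite mulN1r.
Qed.

Definition running_max L x : R := \big[Num.max/0]_(n < L.+1) `|f n x|.

Lemma running_max_ge L n x : (n <= L)%N -> `|f n x| <= running_max L x.
Proof.
by move=> nL; rewrite /running_max (bigmaxD1 (Ordinal (nL : (n < L.+1)%N)))//= le_max lexx.
Qed.

Lemma running_max_ge0 L x : 0 <= running_max L x.
Proof. exact: le_trans (running_max_ge x (leq0n L)). Qed.

Variable o : walsh_group.
Notation mean := (mean o).

(** The bad value may sit on the sibling, but one of the two siblings carries at
    least half of their common mass. *)
Lemma mean_first_bad lam n L : (n <= L)%N ->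
  mean L (fun x => (first_bad lam n x)%:R) <=
  2 * mean L (fun x => (first_bad lam n x)%:R * (lam < `|f n x|)%R%:R) :> R.
Proof.
move=> nL; case: n nL => [|n] nL.
  rewrite -meanZ; apply: ler_mean => x; rewrite /first_bad /=.
  by case: (lam < _); rewrite ?mulr1 ?mulr0// ler1n.
set g := fun x => (first_bad lam n.+1 x)%:R * _.
have gn : depends n.+1 g.
  move=> x y xy; rewrite /g (depends_le (leq_pred n.+1) (@depends_first_bad lam n.+1) xy).
  by rewrite (depends_f xy).
have -> : mean L g = mean L (average n g).
  have an := depends_average gn.
  rewrite /mean (averages_iota_depends gn nL) (averages_iota_depends an (ltnW nL)).
  by rewrite -(addn1 n) iotaD averages_cat.
rewrite -meanZ; apply: ler_mean => x; rewrite /average mulrC divfK//.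
rewrite /g !(depends_put _ _ (@depends_first_bad lam n.+1) (leqnn n)) -mulrDr /first_bad /=.
case: (alive lam n x) => /=; last by rewrite mul0r.
by case: (lam < _) (lam < _) => [] []; rewrite /= ?mul0r// mul1r -natrD ler_nat.
Qed.

Lemma sum_mean_first_bad lam L :
  \sum_(n < L.+1) mean L (fun x => (first_bad lam n x)%:R) <=
  2 * mean L (fun x => (lam < running_max L x)%R%:R) :> R.
Proof.
apply: (@le_trans _ _ (\sum_(n < L.+1)
   2 * mean L (fun x => (first_bad lam n x)%:R * (lam < `|f n x|)%R%:R))).
  by apply: ler_sum => n _; rewrite mean_first_bad// -ltnS.
rewrite -mulr_sumr ler_wpM2l// -mean_sum; apply: ler_mean => x.
apply: (@le_trans _ _ (\sum_(n < L.+1) (first_bad lam n x)%:R * (lam < running_max L x)%R%:R)).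
  apply: ler_sum => n _; rewrite ler_wpM2l// ler_nat.
  have nL : (n <= L)%N by rewrite -ltnS.
  by case: ltP => // /lt_le_trans/(_ (running_max_ge x nL)) ->.
by rewrite -mulr_suml sum_first_bad ler_piMl// lern1 leq_b1.
Qed.

End stopping.

(** * The discrete maximal inequality *)

Section finite_bound.
Context {R : realType}.
Variable p : R.
Hypothesis p_gt0 : 0 < p.
Hypothesis p_lt : p < 1 / 2.
Variable o : walsh_group.
Notation w := (2 `^ p).
Notation mean := (mean o).

(** The summands that do not vanish form a geometric progression whose last term is
    less than [y `^ p]. *)
Lemma sum_levels (lam y : R) K : 0 < lam -> 0 <= y ->
  \sum_(k < K) (lam * 2 ^+ k) `^ p * (lam * 2 ^+ k < y)%R%:R <= w / (w - 1) * y `^ p.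
Proof.
move=> l0 y0; have w1 := two_powR_gt1 p_gt0.
have c0 : 0 <= w / (w - 1) by rewrite divr_ge0 ?powR_ge0// subr_ge0 ltW.
elim: K => [|K IH]; first by rewrite big_ord0 mulr_ge0 ?powR_ge0.
have [lt|ge] := ltP (lam * 2 ^+ K) y; last first.
  by rewrite big_ord_recr/= ltNge ge/= mulr0 addr0.
apply: (@le_trans _ _ (\sum_(k < K.+1) lam `^ p * w ^+ k)).
  apply: ler_sum => k _; rewrite powRM ?exprn_ge0 ?(ltW l0)// powR_exp_two.
  rewrite -[leRHS]mulr1 ler_wpM2l ?mulr_ge0 ?powR_ge0 ?exprn_ge0 ?powR_ge0//.
  by rewrite lern1 leq_b1.
rewrite -mulr_sumr; apply: (@le_trans _ _ (w / (w - 1) * (lam * 2 ^+ K) `^ p)).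
  rewrite powRM ?exprn_ge0 ?(ltW l0)// powR_exp_two mulrCA ler_wpM2l ?powR_ge0//.
  exact: sum_geometric_gt1.
rewrite ler_wpM2l//; apply: ge0_ler_powR; rewrite ?nnegrE ?(ltW lt)//; first exact: ltW.
by rewrite mulr_ge0 ?exprn_ge0// ltW.
Qed.

Lemma exists_level (lam B : R) : 0 < lam -> exists K, B <= lam * 2 ^+ K.
Proof.
move=> l0; pose x := Num.max 0 (B / lam).
have x0 : 0 <= x by rewrite le_max lexx.
exists (Num.bound x); rewrite mulrC -ler_pdivrMr//.
apply: (@le_trans _ _ x); first by rewrite le_max lexx orbT.
apply: (le_trans (ltW (archi_boundP x0))).
by rewrite -natrX ler_nat ltnW// ltn_expl.
Qed.

Lemma alive_bounded (f : nat -> walsh_group -> R) lam L x :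
  (forall n y, (n <= L)%N -> `|f n y| <= lam) -> alive f lam L x.
Proof.
move=> fl; have nb n : (n <= L)%N -> ~~ bad f lam n x.
  by case: n => [|n] nL /=; rewrite ?negb_or -!leNgt !fl.
elim: L {fl} nb => [|L IH] nb; first exact: (nb 0%N).
rewrite [alive _ _ _ _]/= -/(bad f lam L.+1 x) (nb L.+1)// andbT.
by apply: IH => n nL; apply: nb; exact: leqW.
Qed.

Lemma depends_running_max (f : nat -> walsh_group -> R) L :
  (forall n, depends n (f n)) -> depends L (running_max f L).
Proof.
move=> fn x y xy; apply: eq_bigr => n _; congr `|_|.
by apply: (depends_le _ (fn n)) xy; rewrite -ltnS.
Qed.

Lemma depends_bounded (g : walsh_group -> R) L : depends L g ->
  (forall x, 0 <= g x) -> exists B, forall x, g x <= B.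
Proof.
move=> gL g0; exists (2 ^+ L * mean L g) => x.
by rewrite /mean (depends_averages0 o x gL) -{1}(size_iota 0 L) le_averages.
Qed.

Definition weighted_max L (g : walsh_group -> R) x : R :=
  \big[Num.max/0]_(n < 2 ^ L | (0 < n)%N) weighted p o L n g x `^ p.

(** The stopped martingales at the levels [lam0 * 2 ^ k] telescope from the one at
    level [lam0], an atom at scale [0], up to [f L] itself. *)
Lemma weighted_max_bound : exists2 C : R, 0 < C &
  forall (f : nat -> walsh_group -> R) L, (forall n, depends n (f n)) ->
  (forall n, average n (f n.+1) = f n) ->
  mean L (weighted_max L (f L)) <= C * mean L (fun x => running_max f L x `^ p).
Proof.
have [C C0 HC] := atoms_bound p_gt0 p_lt o.
have w1 := two_powR_gt1 p_gt0.
pose c := w / (w - 1); have c0 : 0 < c by apply: divr_gt0; [exact: two_powR_gt0|rewrite subr_gt0].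
exists (C * (2 * 3 `^ p * c)); first by do !(apply: mulr_gt0 => //); exact: powR_gt0.
move=> f L fn fa; apply/ler_addgt0Pr => e e0.
(* the atom at scale 0 is bounded by lam0, and may cost no more than e *)
pose lam0 := (e / C) `^ p^-1; have lam00 : 0 < lam0 by rewrite powR_gt0// divr_gt0.
have lam0p : lam0 `^ p = e / C.
  by rewrite -powRrM mulVf ?gt_eqF// powRr1// ltW// divr_gt0.
pose lam k := lam0 * 2 ^+ k : R.
have lam_gt0 k : 0 < lam k by rewrite mulr_gt0 ?exprn_gt0.
have lamS k : lam k.+1 = 2 * lam k by rewrite /lam exprS mulrCA.
have lam_le k : lam k <= lam k.+1 by rewrite lamS ler_peMl ?ler1n// ltW.
(* a level K that f never exceeds before time L *)
have [B fB] := depends_bounded (depends_running_max fn) (running_max_ge0 f L).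
have [K BK] := exists_level B lam00.
pose I := option ('I_K * 'I_L.+1).
pose r : seq I := None :: [seq Some i | i <- index_enum _].
pose M (i : I) := if i is Some (k, n) then n.-1 else 0%N.
pose h (i : I) x : R := if i is Some (k, n)
  then (lam k + lam k.+1) * (first_bad f (lam k) n x)%:R else lam 0.
pose b (i : I) x : R := if i is Some (k, n)
  then piece f (lam k) (lam k.+1) L n x else stopped f (lam 0) L x.
have at_b i : atom L (M i) (h i) (b i).
  case: i => [[k n]|]; last first.
    split=> //; [|by left] => x; exact/stopped_norm/ltW.
  by apply: atom_piece => //; [exact: ltW|rewrite -ltnS].
have fE : f L = fun x => \sum_(i <- r) b i x.
  apply/funext => x; rewrite big_cons big_map /=.
  rewrite [X in _ + X](_ : _ = \sum_(k < K) \sum_(n < L.+1)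
    piece f (lam k) (lam k.+1) L n x); last first.
    by rewrite pair_bigA; apply: eq_bigr => -[k n].
  under eq_bigr do rewrite sum_piece//.
  rewrite -(big_mkord xpredT (fun k => stopped f (lam k.+1) L x - stopped f (lam k) L x)).
  rewrite telescope_sumr// addrC subrK alive_stopped//.
  apply: alive_bounded => n y nL.
  exact: le_trans (running_max_ge f y nL) (le_trans (fB y) BK).
have [G [G0 Gw Gm]] := HC _ r _ _ _ _ at_b.
apply: (@le_trans _ _ (mean L G)).
  apply: ler_mean => x; apply: bigmax_le => // n n0; rewrite fE; exact: Gw.
apply: le_trans Gm _; rewrite -mulrA.
apply: (@le_trans _ _ (C * (e / C +
    2 * 3 `^ p * c * mean L (fun x => running_max f L x `^ p)))); last first.
  by rewrite mulrDr mulrC divfK ?gt_eqF// addrC !mulrA.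
rewrite ler_pM2l// big_cons big_map; apply: lerD.
  by rewrite /= /mean averages_cst /lam expr0 mulr1 lam0p.
rewrite (_ : \sum_(_ <- _) _ = \sum_(k < K) \sum_(n < L.+1)
    mean L (fun x => ((lam k + lam k.+1) * (first_bad f (lam k) n x)%:R) `^ p)); last first.
  by rewrite pair_bigA; apply: eq_bigr => -[k n].
apply: (@le_trans _ _ (\sum_(k < K) 2 * 3 `^ p *
    (lam k `^ p * mean L (fun x => (lam k < running_max f L x)%R%:R)))).
  apply: ler_sum => k _.
  apply: (@le_trans _ _ (\sum_(n < L.+1) (3 `^ p * lam k `^ p) *
      mean L (fun x => (first_bad f (lam k) n x)%:R))).
    apply: ler_sum => n _; rewrite -meanZ; apply: ler_mean => x.
    rewrite (_ : lam k + lam k.+1 = 3 * lam k); last by rewrite lamS; ring.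
    have l0 := ltW (lam_gt0 k); have l30 : 0 <= 3 * lam k by rewrite mulr_ge0.
    rewrite (powRM _ l30 (ler0n _ _)) (powRM _ (ler0n R 3) l0).
    by case: first_bad; rewrite ?powR1 ?mulr1// powR0 ?gt_eqF// mulr0.
  rewrite -mulr_sumr [leRHS](_ : _ = (3 `^ p * lam k `^ p) *
    (2 * mean L (fun x => (lam k < running_max f L x)%R%:R))); last by ring.
  by rewrite ler_wpM2l ?mulr_ge0 ?powR_ge0// sum_mean_first_bad.
rewrite -mulr_sumr -[leRHS]mulrA ler_wpM2l ?mulr_ge0 ?powR_ge0//.
under eq_bigr do rewrite -meanZ.
rewrite -mean_sum -meanZ; apply: ler_mean => x.
by apply: sum_levels => //; exact: running_max_ge0.
Qed.

End finite_bound.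

(** * From averages to the Haar integral *)

Section bridge.
Context {R : realType}.

Lemma depends_measurable n (g : walsh_group -> R) :
  depends n g -> measurable_fun [set: walsh_group] g.
Proof.
elim: n g => [|n IH] g gn.
  rewrite (_ : g = cst (g point)); first exact: measurable_cst.
  by apply/funext => x; exact: gn.
rewrite (_ : g = fun x => if Defs.coord x n then g (put n true x) else g (put n false x)).
  apply: measurable_fun_ifT; first exact: measurable_coord.
  - exact: IH (depends_put_eq true gn).
  - exact: IH (depends_put_eq false gn).
by apply/funext => x; rewrite -{1}(put_id n x) /Defs.coord; case: (x n).
Qed.

Lemma dyadic_intervalS n x : dyadic_interval n x =
  dyadic_interval n.+1 (put n false x) `|` dyadic_interval n.+1 (put n true x).
Proof.
have E b y : dyadic_interval n.+1 (put n b x) y <->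
    dyadic_interval n x y /\ Defs.coord y n = b.
  rewrite /dyadic_interval /=; split=> [h|[h yn] i].
    split=> [i ilt|]; last by rewrite h// /Defs.coord /put eqxx.
    by rewrite h ?leqW// /Defs.coord /put ltn_eqF.
  rewrite ltnS leq_eqVlt /Defs.coord /put; case: eqVneq => [-> //|_ /= ilt].
  exact: h.
apply/seteqP; split=> y.
  by move=> xy; case: (Defs.coord y n) (E (Defs.coord y n) y) => [[_ e]|[_ e]];
    [right|left]; apply: e.
by case=> /E[].
Qed.

(** A dyadic interval is the union of its two halves, which are disjoint; halving
    [d] times leads to intervals on which [g] is constant. *)
Lemma integral_dyadic_interval m d (g : walsh_group -> R) x : depends (m + d) g ->
  (\int[haar R]_(y in dyadic_interval m x) (g y)%:E =
   (2^-1 ^+ m * averages (iota m d) g x)%:E)%E.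
Proof.
elim: d m x => [|d IH] m x.
  rewrite addn0 => gm; rewrite (eq_integral (cst (g x)%:E)); last first.
    move=> y; rewrite inE => xy; congr (_%:E); exact: gm.
  rewrite integral_cst; last exact: measurable_dyadic_interval.
  by rewrite [X in (_ * X)%E](haar_dyadic_interval R m x) -EFinM mulrC.
rewrite addnS -addSn => gm; rewrite dyadic_intervalS integral_setU.
- rewrite !IH// -EFinD /= /average; congr (_%:E).
  by rewrite exprS; field.
- exact: measurable_dyadic_interval.
- exact: measurable_dyadic_interval.
- by apply/measurable_EFinP; exact: measurable_funTS (depends_measurable gm).
- apply/eqP/seteqP; split=> // y [/(_ m (leqnn _)) + /(_ m (leqnn _))].
  by rewrite /Defs.coord /put eqxx => ->.
Qed.

Lemma integral_depends L (g : walsh_group -> R) o : depends L g ->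
  (\int[haar R]_x (g x)%:E = (mean o L g)%:E)%E.
Proof.
move=> gL; have -> : [set: walsh_group] = dyadic_interval 0 o.
  by apply/esym; rewrite -subTset => y _ i.
by rewrite (@integral_dyadic_interval 0 L)// expr0 mul1r.
Qed.

(** The unions of dyadic intervals of order [n] form a sigma-algebra. *)
Lemma dyadic_measurable_depends n (A : set walsh_group) :
  <<s dyadic_intervals n >> A -> depends n A.
Proof.
move: A; apply: smallest_sub; last first.
  move=> _ [x _ <-] y z yz; apply/propext; rewrite /dyadic_interval /=.
  by split=> h i ilt; rewrite -h// /Defs.coord yz.
split=> /=.
- by move=> x y _.
- by move=> A hA x y xy; rewrite /= (hA x y xy).
- move=> F hF x y xy; apply/propext; split=> -[i _ Fi]; exists i => //.
    by rewrite -(hF i x y xy).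
  by rewrite (hF i x y xy).
Qed.

Variable f : nat -> walsh_group -> R.
Hypothesis mf : is_martingale f.

Lemma martingale_depends n : depends n (f n).
Proof.
move=> x y xy; have [/(_ n [set f n x] (measurable_set1 _)) + _ _] := mf.
move=> /dyadic_measurable_depends/(_ x y xy) E.
by have : (f n @^-1` [set f n x]) y by rewrite -E.
Qed.

Lemma martingale_average n : average n (f n.+1) = f n.
Proof.
apply/funext => x; have [_ _ /(_ n n.+1 (leqnSn n) (dyadic_interval n x))] := mf.
have -> : (\int[haar R]_(y in dyadic_interval n x) (f n.+1 y)%:E)%E =
    (2^-1 ^+ n * average n (f n.+1) x)%:E.
  by rewrite (@integral_dyadic_interval n 1)//; rewrite addn1; exact: martingale_depends.
rewrite (@integral_dyadic_interval n 0); last first.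
  by rewrite addn0; exact: martingale_depends.
move=> H; have {H} : (2^-1 ^+ n * average n (f n.+1) x)%:E = (2^-1 ^+ n * f n x)%:E.
  by apply: H; apply: sub_sigma_algebra; exists x.
by case=> /mulfI; apply; rewrite expf_neq0// invr_eq0.
Qed.

Variable o : walsh_group.

Lemma martingale_averages m d : averages (iota m d) (f (m + d)) = f m.
Proof.
elim: d m => [|d IH] m; first by rewrite addn0.
by rewrite /= -addSnnS IH martingale_average.
Qed.

(** The sequence whose limit defines the coefficient is constant from [L] on. *)
Lemma fourier_coefE L i : (i < 2 ^ L)%N ->
  fourier_coef f i = mean o L (fun t => f L t * kaczmarz R i t).
Proof.
move=> iL; have kL := @depends_kaczmarz R L i iL.
have D k : (L <= k)%N -> depends k (fun t => f k t * kaczmarz R i t).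
  move=> Lk x y xy; rewrite (martingale_depends xy).
  by rewrite (depends_le Lk kL xy).
apply: lim_near_cst => //; exists L => // k /= Lk.
rewrite /Rintegral (integral_depends o (D k Lk))/=.
rewrite /mean -{1}(subnKC Lk) iotaD averages_cat add0n.
congr (averages _ _ _); apply/funext => t.
rewrite (_ : (fun t => _) = (fun t => kaczmarz R i t * f k t)); last first.
  by apply/funext => y; rewrite mulrC.
rewrite averages_invarM => [|j b y]; last first.
  by rewrite mem_iota => /andP[Lj _]; exact: depends_put kL Lj.
by rewrite -{2}(subnKC Lk) martingale_averages mulrC.
Qed.

Lemma fejer_meanE L n x : (n <= 2 ^ L)%N ->
  fejer_mean f n x = n%:R^-1 * fejer o L n (f L) x.
Proof.
move=> nL; rewrite /fejer_mean; congr (_ * _).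
rewrite /fejer /convolution /partial_sum.
transitivity (\sum_(j < n) \sum_(i < j)
    mean o L (fun t => f L t * kaczmarz R i (translate x t))).
  apply: eq_bigr => j _; apply: eq_bigr => i _; rewrite (@fourier_coefE L).
    rewrite mulrC -meanZ; congr mean; apply/funext => t.
    by rewrite kaczmarz_translate mulrCA.
  by apply: leq_trans nL; exact: ltn_trans (ltn_ord i) (ltn_ord j).
under eq_bigr do rewrite -mean_sum.
rewrite -mean_sum; congr mean; apply/funext => t.
rewrite /fejer_sum /dirichlet_sum mulr_sumr; apply: eq_bigr => j _.
by rewrite mulr_sumr.
Qed.

Lemma depends_fejer_mean L n : (n <= 2 ^ L)%N -> depends L (fejer_mean f n).
Proof.
move=> nL x y xy; rewrite /fejer_mean; congr (_ * _).
apply: eq_bigr => j _; apply: eq_bigr => i _; congr (_ * _).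
apply: (depends_kaczmarz _ xy).
by apply: leq_trans nL; exact: ltn_trans (ltn_ord i) (ltn_ord j).
Qed.

End bridge.

(** * Passage to the limit *)

Section suprema.
Context {R : realType}.

Lemma measurable_sup_depends (u : nat -> walsh_group -> R) (L : nat -> nat) :
  (forall n, depends (L n) (u n)) ->
  measurable_fun [set: walsh_group]
    (fun x => ereal_sup [set (u n x)%:E | n in [set: nat]]).
Proof.
move=> uL; rewrite (_ : (fun x => _) = (fun x => esups (fun n => (u n x)%:E) 0)).
  apply: measurable_fun_esups => n; apply/measurable_EFinP.
  exact: depends_measurable (uL n).
apply/funext => x; congr ereal_sup; apply/seteqP; split=> y.
  by move=> [n _ <-]; exists n.
by move=> [n _ <-]; exists n.
Qed.

Lemma measurable_abse_poweR (g : walsh_group -> \bar R) (p : R) :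
  measurable_fun [set: walsh_group] g ->
  measurable_fun [set: walsh_group] (fun x => `|g x| `^ p)%E.
Proof.
move=> mg; apply: (measurableT_comp (measurable_poweR p)).
exact: measurableT_comp.
Qed.

Lemma le_sup_abse (u : nat -> R) (D : set nat) n : D n ->
  ((u n)%:E <= `|ereal_sup [set (u n)%:E | n in D]|)%E.
Proof.
move=> Dn; apply: le_trans (lee_abs _).
by apply: ereal_sup_ubound; exists n.
Qed.

End suprema.

Theorem theorem1 (R : realType) (p : R) (p_gt0 : 0 < p) (p_lt : p < 1 / 2) :
  exists c : R, 0 < c /\
    forall f : nat -> walsh_group -> R, in_Hardy p f ->
      ('N[haar R]_p%:E[weighted_fejer_maximal p f] <= c%:E * Hardy_norm p f)%E.
Proof.
pose o : walsh_group := fun=> false.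
have [C C0 HC] := weighted_max_bound p_gt0 p_lt o.
have p0 := ltW p_gt0; have pn0 : p != 0 by rewrite gt_eqF.
exists (C `^ p^-1); split=> [|f [mf _]]; first exact: powR_gt0.
have fn := martingale_depends mf.
pose v n x := `|fejer_mean f n x| / (n.+1%:R `^ (p^-1 - 2)).
have v0 n x : 0 <= v n x by rewrite divr_ge0 ?powR_ge0.
have dv L n : (n <= 2 ^ L)%N -> depends L (v n).
  by move=> nL x y xy; rewrite /v (depends_fejer_mean f nL xy).
pose V L := weighted_max p o L (f L).
have VE L x : V L x = \big[Num.max/0]_(n < 2 ^ L | (0 < n)%N) v n x `^ p.
  by apply: eq_bigr => n n0; rewrite /weighted -(fejer_meanE mf)// ltnW.
have V0 L x : 0 <= V L x by exact: bigmax_ge_id.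
have Vnd x : nondecreasing_seq (fun L => (V L x)%:E).
  move=> m n mn; rewrite lee_fin !VE.
  apply: (le_bigmax_ord _ (fun n => v n x `^ p)).
  by rewrite leq_exp2l.
have VL L : depends L (V L).
  by move=> x y xy; rewrite !VE; apply: eq_bigr => n _; rewrite (dv L n (ltnW (ltn_ord n)) _ _ xy).
have mV L : measurable_fun [set: walsh_group] (fun x => (V L x)%:E).
  by apply/measurable_EFinP; exact: depends_measurable (VL L).
have mM : measurable_fun [set: walsh_group] (maximal_function f).
  apply: (@measurable_sup_depends _ (fun n x => `|f n x|) id) => n x y xy.
  by rewrite (fn n x y xy).
have wE : weighted_fejer_maximal p f =
    fun x => ereal_sup [set (v n.+1 x)%:E | n in [set: nat]].
  apply/funext => x; congr ereal_sup; apply/seteqP; split=> y.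
    by case=> -[|n]//= _ <-; exists n.
  by case=> n _ <-; exists n.+1.
have mW : measurable_fun [set: walsh_group] (weighted_fejer_maximal p f).
  rewrite wE; apply: (@measurable_sup_depends _ (fun n => v n.+1) succn) => n.
  by apply: dv; exact/ltnW/ltn_expl.
have bound L : (\int[haar R]_x (V L x)%:E <=
    C%:E * \int[haar R]_x (`|maximal_function f x| `^ p))%E.
  rewrite (integral_depends o (VL L)).
  apply: (@le_trans _ _ (C%:E * (mean o L (fun x => running_max f L x `^ p))%:E)%E).
    by rewrite -EFinM lee_fin; apply: HC => //; exact: martingale_average.
  have rL : depends L (fun x => running_max f L x `^ p).
    by move=> x y xy; rewrite (depends_running_max fn xy).
  rewrite -(integral_depends o rL) lee_pmul2l//.
  apply: ge0_le_integral => //.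
  - by move=> x _; rewrite lee_fin powR_ge0.
  - by apply/measurable_EFinP; exact: depends_measurable rL.
  - exact: measurable_abse_poweR.
  - move=> x _; rewrite -poweR_EFin; apply: gt0_ler_poweR => //.
    + by rewrite in_itv/= leey lee_fin running_max_ge0.
    + by rewrite in_itv/= leey abse_ge0.
    have fM n := @le_sup_abse _ (fun n => `|f n x|) setT n I.
    rewrite /running_max; elim/big_ind : _ => [|y z yM zM|n _]; last exact: fM.
      by apply: le_trans (fM 0%N); rewrite lee_fin.
    by rewrite maxEle; case: ifP.
have lim_bound : (\int[haar R]_x (`|weighted_fejer_maximal p f x| `^ p) <=
    C%:E * \int[haar R]_x (`|maximal_function f x| `^ p))%E.
  apply: (@le_trans _ _ (\int[haar R]_x limn (fun L => (V L x)%:E))%E).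
    apply: ge0_le_integral => //.
    - by move=> x _; exact: poweR_ge0.
    - exact: measurable_abse_poweR.
    - apply: (@emeasurable_fun_cvg _ _ _ _ (fun L x => (V L x)%:E)) => // x _.
      exact: ereal_nondecreasing_is_cvgn (Vnd x).
    move=> x _; set l := limn _.
    have lV L : ((V L x)%:E <= l)%E.
      rewrite /l (cvg_lim _ (ereal_nondecreasing_cvgn (Vnd x)))//.
      by apply: ereal_sup_ubound; exists L.
    have l0 : (0 <= l)%E by apply: le_trans (lV 0%N); rewrite lee_fin.
    (* the supremum is bounded before it is raised to the power p *)
    have lE : l = ((l `^ p^-1) `^ p)%E by rewrite -poweRrM mulVf// poweRe1.
    rewrite lE; apply: gt0_ler_poweR => //.
    - by rewrite in_itv/= leey abse_ge0.
    - by rewrite in_itv/= leey poweR_ge0.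
    rewrite gee0_abs; last first.
      apply: le_trans (_ : 0 <= (v 1 x)%:E)%E _; first by rewrite lee_fin.
      by apply: ereal_sup_ubound; exists 1%N.
    apply: ge_ereal_sup => _ [n /= n1 <-].
    rewrite -/(v n x) -[v n x]powRr1// -(mulfV pn0) powRrM -poweR_EFin.
    apply: gt0_ler_poweR; rewrite ?invr_ge0// ?in_itv/= ?leey ?l0 ?lee_fin ?powR_ge0//.
    apply: le_trans (lV n); rewrite lee_fin VE.
    have n2 : (n < 2 ^ n)%N by exact: ltn_expl.
    by rewrite (bigmaxD1 (Ordinal n2))//= le_max lexx.
  rewrite monotone_convergence//; last by move=> n x _; rewrite lee_fin.
  apply: lime_le; last by apply: nearW => L; exact: bound.
  apply: ereal_nondecreasing_is_cvgn => m n mn.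
  apply: ge0_le_integral => // [x _|x _]; first by rewrite lee_fin.
  exact: Vnd.
have M0 : (0 <= \int[haar R]_x (`|maximal_function f x| `^ p))%E.
  by apply: integral_ge0 => x _; exact: poweR_ge0.
rewrite /Hardy_norm unlock -poweR_EFin -poweRM ?lee_fin ?(ltW C0)//.
apply: gt0_ler_poweR; rewrite ?invr_ge0// ?in_itv/= ?leey ?mule_ge0 ?lee_fin ?(ltW C0)//.
by rewrite andbT; apply: integral_ge0 => x _; exact: poweR_ge0.
Qed.
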